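(* Let $\rho_{ABC}$ be a positive definite density operator on $\mathcal{H}_{ABC}$. Then $\lim_{\alpha\to1}I_\alpha(A;B|C)_\rho=I(A;B|C)_\rho$.
   Context: Finite-dimensional Hilbert spaces; natural log; operator powers via spectral calculus (negative powers on the support); operators on subsystems tensored with identities; subscripts denote marginals. $I(A;B|C)_\rho=H(AC)+H(BC)-H(C)-H(ABC)$ (von Neumann entropies). For $\alpha\in[0,1)\cup(1,\infty)$, $I_\alpha(A;B|C)_\rho\equiv\inf_{\sigma_{BC}}\frac{1}{\alpha-1}\log\operatorname{Tr}\{\rho_{ABC}^{\alpha}\rho_{AC}^{(1-\alpha)/2}\rho_C^{(\alpha-1)/2}\sigma_{BC}^{1-\alpha}\rho_C^{(\alpha-1)/2}\rho_{AC}^{(1-\alpha)/2}\}$, the infimum over density operators $\sigma_{BC}$ with $\operatorname{supp}(\rho_{ABC})\subseteq\operatorname{supp}(I_A\otimes\sigma_{BC})$. *)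

(* Defs.v *)
From Stdlib Require Import Reals List ClassicalEpsilon.
Import ListNotations.
Open Scope R_scope.

Record C := mkC { Cre : R; Cim : R }.
Definition Czero : C := mkC 0 0.
Definition Cone : C := mkC 1 0.
Definition RtoC (r : R) : C := mkC r 0.
Definition Cadd (x y : C) : C := mkC (Cre x + Cre y) (Cim x + Cim y).
Definition Cmul (x y : C) : C :=
  mkC (Cre x * Cre y - Cim x * Cim y) (Cre x * Cim y + Cim x * Cre y).
Definition Cconj (x : C) : C := mkC (Cre x) (- Cim x).
Definition Csum {I : Type} (l : list I) (f : I -> C) : C :=
  fold_right (fun i acc => Cadd (f i) acc) Czero l.

(* ---------- vectors / operators on a finite index set given by an
   enumeration list l (entries outside l are irrelevant) ---------- *)
Definition Vec (I : Type) := I -> C.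
Definition Op (I : Type) := I -> I -> C.

Definition Omul {I : Type} (l : list I) (X Y : Op I) : Op I :=
  fun i j => Csum l (fun k => Cmul (X i k) (Y k j)).
Definition Oapp {I : Type} (l : list I) (X : Op I) (v : Vec I) : Vec I :=
  fun i => Csum l (fun k => Cmul (X i k) (v k)).
Definition inner {I : Type} (l : list I) (v w : Vec I) : C :=
  Csum l (fun i => Cmul (Cconj (v i)) (w i)).
Definition Otr {I : Type} (l : list I) (X : Op I) : C := Csum l (fun i => X i i).

Definition hermitian {I : Type} (l : list I) (X : Op I) : Prop :=
  forall i j, In i l -> In j l -> X i j = Cconj (X j i).
Definition psd {I : Type} (l : list I) (X : Op I) : Prop :=
  hermitian l X /\ forall v : Vec I, 0 <= Cre (inner l v (Oapp l X v)).
Definition posdef {I : Type} (l : list I) (X : Op I) : Prop :=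
  hermitian l X /\
  forall v : Vec I, (exists i, In i l /\ v i <> Czero) ->
    0 < Cre (inner l v (Oapp l X v)).
Definition density {I : Type} (l : list I) (X : Op I) : Prop :=
  psd l X /\ Otr l X = Cone.

(* supp(X) ⊆ supp(Y): the range (= support, for Hermitian operators) of X
   is contained in the range of Y *)
Definition supp_incl {I : Type} (l : list I) (X Y : Op I) : Prop :=
  forall v : Vec I, exists w : Vec I,
    forall i, In i l -> Oapp l X v i = Oapp l Y w i.

Definition zerovec {I : Type} : Vec I := fun _ => Czero.

Definition is_eigdecomp {I : Type} (l : list I) (X : Op I)
    (vs : list (Vec I)) (lams : list R) : Prop :=
  length vs = length l /\ length lams = length l /\
  (forall k k', (k < length l)%nat -> (k' < length l)%nat ->
     inner l (nth k vs zerovec) (nth k' vs zerovec)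
       = if Nat.eq_dec k k' then Cone else Czero) /\
  (forall i j, In i l -> In j l ->
     X i j = Csum (seq 0 (length l)) (fun k =>
        Cmul (RtoC (nth k lams 0))
             (Cmul (nth k vs zerovec i) (Cconj (nth k vs zerovec j))))).

Definition eigdecomp {I : Type} (l : list I) (X : Op I) : list (Vec I) * list R :=
  match excluded_middle_informative
          (exists p : list (Vec I) * list R, is_eigdecomp l X (fst p) (snd p)) with
  | left H => proj1_sig (constructive_indefinite_description _ H)
  | right _ => ([], [])
  end.

Definition Ofun {I : Type} (l : list I) (f : R -> R) (X : Op I) : Op I :=
  let vs := fst (eigdecomp l X) in
  let lams := snd (eigdecomp l X) in
  fun i j => Csum (seq 0 (length l)) (fun k =>
     Cmul (RtoC (f (nth k lams 0)))
          (Cmul (nth k vs zerovec i) (Cconj (nth k vs zerovec j)))).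

(* x^t on the support (x > 0), 0 on the kernel *)
Definition pw (t x : R) : R := if Rlt_dec 0 x then Rpower x t else 0.
Definition Opow {I : Type} (l : list I) (X : Op I) (t : R) : Op I := Ofun l (pw t) X.

Definition eta (x : R) : R := if Rlt_dec 0 x then x * ln x else 0.
Definition vN_entropy {I : Type} (l : list I) (X : Op I) : R :=
  - fold_right Rplus 0 (map eta (snd (eigdecomp l X))).

Definition enA (d : nat) : list nat := seq 0 d.
Definition enABC (dA dB dC : nat) : list (nat * nat * nat) :=
  flat_map (fun a => flat_map (fun b => map (fun c => (a, b, c)) (seq 0 dC))
                                (seq 0 dB)) (seq 0 dA).
Definition enPair (d1 d2 : nat) : list (nat * nat) :=
  flat_map (fun x => map (fun y => (x, y)) (seq 0 d2)) (seq 0 d1).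

Definition tA (x : nat * nat * nat) : nat := fst (fst x).
Definition tB (x : nat * nat * nat) : nat := snd (fst x).
Definition tC (x : nat * nat * nat) : nat := snd x.

Definition margAC (dB : nat) (rho : Op (nat * nat * nat)) : Op (nat * nat) :=
  fun x y => Csum (seq 0 dB) (fun b => rho (fst x, b, snd x) (fst y, b, snd y)).
Definition margBC (dA : nat) (rho : Op (nat * nat * nat)) : Op (nat * nat) :=
  fun x y => Csum (seq 0 dA) (fun a => rho (a, fst x, snd x) (a, fst y, snd y)).
Definition margC (dA dB : nat) (rho : Op (nat * nat * nat)) : Op nat :=
  fun c c' => Csum (seq 0 dA) (fun a => Csum (seq 0 dB) (fun b => rho (a, b, c) (a, b, c'))).

Definition kd (m n : nat) : bool := Nat.eqb m n.
Definition liftAC (X : Op (nat * nat)) : Op (nat * nat * nat) :=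
  fun x y => if kd (tB x) (tB y) then X (tA x, tC x) (tA y, tC y) else Czero.
Definition liftBC (X : Op (nat * nat)) : Op (nat * nat * nat) :=
  fun x y => if kd (tA x) (tA y) then X (tB x, tC x) (tB y, tC y) else Czero.
Definition liftC (X : Op nat) : Op (nat * nat * nat) :=
  fun x y => if andb (kd (tA x) (tA y)) (kd (tB x) (tB y)) then X (tC x) (tC y) else Czero.

Definition CMI (dA dB dC : nat) (rho : Op (nat * nat * nat)) : R :=
  vN_entropy (enPair dA dC) (margAC dB rho)
  + vN_entropy (enPair dB dC) (margBC dA rho)
  - vN_entropy (enA dC) (margC dA dB rho)
  - vN_entropy (enABC dA dB dC) rho.

Definition renyiTr (dA dB dC : nat) (a : R) (rho : Op (nat * nat * nat))
    (sigma : Op (nat * nat)) : C :=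
  let l := enABC dA dB dC in
  let PAC := liftAC (Opow (enPair dA dC) (margAC dB rho) ((1 - a) / 2)) in
  let PC := liftC (Opow (enA dC) (margC dA dB rho) ((a - 1) / 2)) in
  let S := liftBC (Opow (enPair dB dC) sigma (1 - a)) in
  Otr l (Omul l (Opow l rho a)
          (Omul l PAC (Omul l PC (Omul l S (Omul l PC PAC))))).

(* infimum of a set of reals (0 if it has no greatest lower bound) *)
Definition is_glb (S : R -> Prop) (m : R) : Prop :=
  (forall y, S y -> m <= y) /\ (forall m', (forall y, S y -> m' <= y) -> m' <= m).
Definition Rinf (S : R -> Prop) : R :=
  match excluded_middle_informative (exists m, is_glb S m) with
  | left H => proj1_sig (constructive_indefinite_description _ H)
  | right _ => 0
  end.

Definition renyiCMI (dA dB dC : nat) (a : R) (rho : Op (nat * nat * nat)) : R :=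
  Rinf (fun y => exists sigma : Op (nat * nat),
          density (enPair dB dC) sigma /\
          supp_incl (enABC dA dB dC) rho (liftBC sigma) /\
          y = / (a - 1) * ln (Cre (renyiTr dA dB dC a rho sigma))).

(* Main.v *)
(** Write [e = 1 - a]. By cyclicity the trace in the Renyi quantity is [X = Tr (T_a sigma^e)], where
    [T_a = Tr_A (rho_C^(-e/2) rho_AC^(e/2) rho^a rho_AC^(e/2) rho_C^(-e/2))] does not depend on [sigma] and
    [T_1 = rho_BC]. Differentiating at [a = 1] with [sigma = rho_BC] bounds the upper limit by the conditional
    mutual information.

    For the lower bound, let [(w_j, s_j)] diagonalize [sigma] and put [t_j = <w_j, T_a w_j>],
    [r_j = <w_j, rho_BC w_j>], so that [X = sum_j t_j s_j^e]. The [r_j] are bounded away from [0] and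
    [t_j = r_j + O(e)], both uniformly in [sigma], so the tangent line of the concave function [s^e / e] at [r_j]
    gives [X / e <= Tr T_a / e + sum_j r_j ln r_j + sum_j (s_j - r_j) + O(e)]. Here the last sum vanishes and
    [sum_j r_j ln r_j <= Tr (rho_BC ln rho_BC)] by Peierls' inequality. This replaces the Sibson identity and the
    matrix Hoelder inequality, and only powers of fixed operators have to be differentiated. *)
From Stdlib Require Import Reals List Lra Lia Ring ClassicalEpsilon FunctionalExtensionality.
Require Import Defs.
From mathcomp Require ssreflect ssrfun ssrbool eqtype ssrnat seq fintype bigop order ssralg ssrnum matrix mxalgebra sesquilinear spectral complex Rstruct.
Open Scope R_scope.

(** * Spectral theorem *)

(** The obstacle is uniformity in [sigma]: its eigenvalues may lie arbitrarily close to [0], where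
    the expansion [s^e = 1 + e ln s + O(e^2)] has no uniform error term. The lower bound needs only
    a one-sided estimate, and concavity supplies one for every [s > 0]; taking the tangent at [r_j]
    makes it sharp to first order when [sigma] is [rho_BC]. Dividing by [e] keeps the function
    concave for both signs of [e], so [a < 1] and [a > 1] are treated together until the final
    logarithm. The term [Tr T_a / e] alone diverges. After subtracting [1 / e] it becomes minus a
    difference quotient of [Tr T_a] at [a = 1], which yields the entropies of [AC], [C] and [ABC];
    Peierls' inequality yields that of [BC]. Since [eigdecomp] picks a decomposition by classical
    choice, nothing is known about how it varies with the operator. The eigenvectors of the fixed
    operators do not move with [a], so the entries of their powers are finite sums of scalar
    exponentials. *)

Definition kronecker (k k' : nat) : C := if Nat.eq_dec k k' then Cone else Czero.

Module MatrixBridge.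
Import ssreflect ssrfun ssrbool eqtype ssrnat seq fintype bigop order ssralg ssrnum matrix mxalgebra sesquilinear spectral complex Rstruct.
Import GRing.Theory Num.Theory.
Local Open Scope ring_scope.

Notation Ri := (complex R).
Definition to_Ri (z : C) : Ri := Complex (Cre z) (Cim z).
Definition of_Ri (z : Ri) : C := mkC (complex.Re z) (complex.Im z).

Lemma to_RiK z : of_Ri (to_Ri z) = z.
Proof. by case: z. Qed.
Lemma of_RiK z : to_Ri (of_Ri z) = z.
Proof. by case: z. Qed.
Lemma to_Ri_inj z w : to_Ri z = to_Ri w -> z = w.
Proof. by move=> E; rewrite -(to_RiK z) E to_RiK. Qed.
Lemma to_RiM z w : to_Ri (Cmul z w) = to_Ri z * to_Ri w.
Proof. by []. Qed.
Lemma to_RiJ z : to_Ri (Cconj z) = (to_Ri z)^*.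
Proof. by []. Qed.

Lemma to_Ri_delta k k' :
  to_Ri (kronecker k k') = (k == k')%:R.
Proof. by rewrite /kronecker; case: Nat.eq_dec => [E|/eqP/negPf ->] //=; rewrite E eqxx. Qed.

Lemma to_Ri_sum n (f : nat -> C) :
  to_Ri (Csum (List.seq 0 n) f) = \sum_(i < n) to_Ri (f i).
Proof.
rewrite -(big_mkord xpredT (fun i => to_Ri (f i))) /index_iota subn0.
elim: n 0%N => [|n IH] m; first by rewrite big_nil.
by rewrite big_cons -IH.
Qed.

Lemma spectral_theorem n (X : nat -> nat -> C) :
  (forall i j, (i < n)%coq_nat -> (j < n)%coq_nat -> X i j = Cconj (X j i)) ->
  exists (V : nat -> nat -> C) (lam : nat -> R),
    (forall k k', (k < n)%coq_nat -> (k' < n)%coq_nat ->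
       Csum (List.seq 0 n) (fun i => Cmul (Cconj (V k i)) (V k' i)) =
         kronecker k k') /\
    (forall i j, (i < n)%coq_nat -> (j < n)%coq_nat ->
       X i j = Csum (List.seq 0 n) (fun k =>
         Cmul (RtoC (lam k)) (Cmul (V k i) (Cconj (V k j))))).
Proof.
case: n => [|n] HX.
  by exists (fun _ _ => Czero), (fun _ => 0); split => i j /ltP.
pose A : 'M[Ri]_n.+1 := \matrix_(i, j) to_Ri (X i j).
have Aherm : A \is hermsymmx.
  apply/is_hermitianmxP; rewrite expr0 scale1r; apply/matrixP => i j.
  by rewrite !mxE -to_RiJ -HX //; apply/ltP.
have Punit := spectral_unitarymx A.
have Dreal := hermitian_spectral_diag_real Aherm.
have /orthomx_spectralP Adec := hermitian_normalmx Aherm.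
move: Punit Dreal Adec; move: (spectralmx A) (spectral_diag A) => P D Punit Dreal Adec.
(* [A = P^-1 diag(D) P] with [P] unitary, so the eigenvectors are the columns of [P^-1], that is,
   the conjugated rows of [P]. *)
exists (fun k i => of_Ri ((P (inord k) (inord i))^*)),
  (fun k => complex.Re (D ord0 (inord k))); split.
  move=> k k' /ltP Hk /ltP Hk'; apply: to_Ri_inj; rewrite to_Ri_sum.
  have /unitarymxP /matrixP /(_ (inord k) (inord k')) := Punit.
  rewrite !mxE => E.
  transitivity ((inord k == inord k' :> 'I_n.+1)%:R : Ri); last first.
    by rewrite to_Ri_delta -val_eqE /= !inordK.
  rewrite -E; apply: eq_bigr => i _.
  by rewrite to_RiM to_RiJ !of_RiK inord_val !mxE conjCK.
move=> i j /ltP Hi /ltP Hj; apply: to_Ri_inj; rewrite to_Ri_sum.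
have /matrixP /(_ (inord i) (inord j)) := Adec.
rewrite invmx_unitary // [in RHS]mxE [in LHS]mxE !inordK // => ->.
apply: eq_bigr => k _; rewrite !to_RiM to_RiJ !of_RiK conjCK inord_val.
rewrite mul_mx_diag !mxE.
have /mxOverP /(_ ord0 k) Dk := Dreal.
have -> : to_Ri (RtoC (complex.Re (D ord0 k))) = D ord0 k.
  move: Dk; case: (D ord0 k) => a b; rewrite complex_real => /eqP b0.
  by rewrite /to_Ri /= b0.
by rewrite mulrCA mulrA mulrAC.
Qed.

(** Orthonormality says that a square matrix has a one-sided inverse, which is then two-sided
    ([mulmx1C]); the other product is the resolution of the identity. *)
Lemma orthonormal_complete n (V : nat -> nat -> C) :
  (forall k k', (k < n)%coq_nat -> (k' < n)%coq_nat ->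
     Csum (List.seq 0 n) (fun i => Cmul (Cconj (V k i)) (V k' i)) =
       kronecker k k') ->
  forall i j, (i < n)%coq_nat -> (j < n)%coq_nat ->
    Csum (List.seq 0 n) (fun k => Cmul (V k i) (Cconj (V k j))) =
      kronecker i j.
Proof.
case: n => [|n] HV i j; first by move=> /ltP.
move=> /ltP Hi /ltP Hj.
pose A : 'M[Ri]_n.+1 := \matrix_(k, i) (to_Ri (V k i))^*.
pose B : 'M[Ri]_n.+1 := \matrix_(i, k) to_Ri (V k i).
have AB : A *m B = 1%:M.
  apply/matrixP => k k'; rewrite !mxE.
  have := HV k k' (ltP (ltn_ord k)) (ltP (ltn_ord k')).
  move=> /(congr1 to_Ri); rewrite to_Ri_sum => E.
  rewrite (eq_bigr (fun i0 : 'I_n.+1 => to_Ri (Cmul (Cconj (V k i0)) (V k' i0)))).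
    by rewrite E to_Ri_delta.
  by move=> l _; rewrite !mxE.
have /matrixP /(_ (inord i) (inord j)) := mulmx1C AB.
rewrite !mxE => E; apply: to_Ri_inj; rewrite to_Ri_sum.
rewrite (eq_bigr (fun k : 'I_n.+1 => B (inord i) k * A k (inord j))).
  by rewrite E to_Ri_delta -val_eqE /= !inordK.
by move=> k _; rewrite !mxE !inordK.
Qed.

End MatrixBridge.

(** * Finite sums and operators *)

Lemma C_eq (x y : C) : Cre x = Cre y -> Cim x = Cim y -> x = y.
Proof. destruct x, y; simpl; congruence. Qed.

Definition Copp (x : C) : C := mkC (- Cre x) (- Cim x).
Definition Csub (x y : C) : C := Cadd x (Copp y).

Lemma C_ring_theory : ring_theory Czero Cone Cadd Cmul Csub Copp eq.
Proof. split; intros; try reflexivity; apply C_eq; simpl; ring. Qed.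
Add Ring C_ring : C_ring_theory.

Lemma Cconj_mul x y : Cconj (Cmul x y) = Cmul (Cconj x) (Cconj y).
Proof. apply C_eq; simpl; ring. Qed.
Lemma Cconj_add x y : Cconj (Cadd x y) = Cadd (Cconj x) (Cconj y).
Proof. apply C_eq; simpl; ring. Qed.
Lemma Cconj_conj x : Cconj (Cconj x) = x.
Proof. apply C_eq; simpl; ring. Qed.
Lemma Cconj_zero : Cconj Czero = Czero.
Proof. apply C_eq; simpl; ring. Qed.
Lemma Cre_scale r z : Cre (Cmul (RtoC r) z) = r * Cre z.
Proof. simpl; ring. Qed.

Definition Cnorm2 (z : C) : R := Cre z * Cre z + Cim z * Cim z.
Lemma Cnorm2_pos z : 0 <= Cnorm2 z.
Proof. unfold Cnorm2; nra. Qed.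
Lemma Cmul_conj z : Cmul (Cconj z) z = RtoC (Cnorm2 z).
Proof. apply C_eq; unfold Cnorm2; simpl; ring. Qed.

Definition Rsum {I : Type} (l : list I) (f : I -> R) : R :=
  fold_right (fun i acc => f i + acc) 0 l.

Section Sums.
Context {I : Type}.
Implicit Types (l : list I) (f g : I -> C) (u v : I -> R).

Lemma Csum_ext l f g : (forall i, In i l -> f i = g i) -> Csum l f = Csum l g.
Proof.
  induction l as [|x l IH]; simpl; intros H; [reflexivity|].
  rewrite H, IH; auto.
Qed.
Lemma Csum_add l f g : Csum l (fun i => Cadd (f i) (g i)) = Cadd (Csum l f) (Csum l g).
Proof. induction l as [|x l IH]; simpl; [ring|rewrite IH; ring]. Qed.
Lemma Csum_zero l : Csum l (fun _ => Czero) = Czero.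
Proof. induction l as [|x l IH]; simpl; [ring|rewrite IH; ring]. Qed.
Lemma Csum_mul_l l c f : Csum l (fun i => Cmul c (f i)) = Cmul c (Csum l f).
Proof. induction l as [|x l IH]; simpl; [ring|rewrite IH; ring]. Qed.
Lemma Csum_mul_r l c f : Csum l (fun i => Cmul (f i) c) = Cmul (Csum l f) c.
Proof. induction l as [|x l IH]; simpl; [ring|rewrite IH; ring]. Qed.
Lemma Csum_conj l f : Cconj (Csum l f) = Csum l (fun i => Cconj (f i)).
Proof.
  induction l as [|x l IH]; simpl; [apply Cconj_zero|].
  rewrite Cconj_add, IH; reflexivity.
Qed.
Lemma Csum_app l l' f : Csum (l ++ l') f = Cadd (Csum l f) (Csum l' f).
Proof. induction l as [|x l IH]; simpl; [ring|rewrite IH; ring]. Qed.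
Lemma Csum_single l i f : NoDup l -> In i l ->
  (forall j, In j l -> j <> i -> f j = Czero) -> Csum l f = f i.
Proof.
  induction l as [|x l IH]; simpl; intros Hnd Hin H; [contradiction|].
  inversion Hnd; subst. destruct Hin as [->|Hin].
  - rewrite (Csum_ext l f (fun _ => Czero)), Csum_zero; [ring|].
    intros j Hj; apply H; [auto|congruence].
  - rewrite IH by auto. rewrite H; [ring|auto|congruence].
Qed.

Lemma Cre_Csum l f : Cre (Csum l f) = Rsum l (fun i => Cre (f i)).
Proof. induction l as [|x l IH]; simpl; congruence. Qed.

Lemma Rsum_ext l u v : (forall i, In i l -> u i = v i) -> Rsum l u = Rsum l v.
Proof.
  induction l as [|x l IH]; simpl; intros H; [reflexivity|].
  rewrite H, IH; auto.
Qed.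
Lemma Rsum_le l u v : (forall i, In i l -> u i <= v i) -> Rsum l u <= Rsum l v.
Proof.
  induction l as [|x l IH]; simpl; intros H; [lra|].
  apply Rplus_le_compat; auto.
Qed.
Lemma Rsum_add l u v : Rsum l (fun i => u i + v i) = Rsum l u + Rsum l v.
Proof. induction l as [|x l IH]; simpl; [ring|rewrite IH; ring]. Qed.
Lemma Rsum_sub l u v : Rsum l (fun i => u i - v i) = Rsum l u - Rsum l v.
Proof. induction l as [|x l IH]; simpl; [ring|rewrite IH; ring]. Qed.
Lemma Rsum_mul_l l c u : Rsum l (fun i => c * u i) = c * Rsum l u.
Proof. induction l as [|x l IH]; simpl; [ring|rewrite IH; ring]. Qed.
Lemma Rsum_const l c : Rsum l (fun _ => c) = INR (length l) * c.
Proof. induction l as [|x l IH]; [simpl; ring|]. cbn [length]. rewrite S_INR. simpl. rewrite IH. ring. Qed.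
Lemma Rsum_nonneg l u : (forall i, In i l -> 0 <= u i) -> 0 <= Rsum l u.
Proof.
  intros H. replace 0 with (Rsum l (fun _ => 0)) by (rewrite Rsum_const; ring).
  apply Rsum_le; exact H.
Qed.
Lemma Rsum_ge_term l u i : (forall j, In j l -> 0 <= u j) -> In i l -> u i <= Rsum l u.
Proof.
  induction l as [|x l IH]; simpl; intros H Hin; [contradiction|].
  destruct Hin as [->|Hin].
  - assert (0 <= Rsum l u) by (apply Rsum_nonneg; auto). lra.
  - assert (u i <= Rsum l u) by (apply IH; auto). pose proof (H x (or_introl eq_refl)). lra.
Qed.
Lemma Rsum_pos l u : l <> nil -> (forall i, In i l -> 0 < u i) -> 0 < Rsum l u.
Proof.
  destruct l as [|x l]; [congruence|]; intros _ H; simpl.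
  assert (0 <= Rsum l u) by (apply Rsum_nonneg; intros; left; apply H; simpl; auto).
  pose proof (H x (or_introl eq_refl)); lra.
Qed.
Lemma Rabs_Rsum l u : Rabs (Rsum l u) <= Rsum l (fun i => Rabs (u i)).
Proof.
  induction l as [|x l IH]; simpl; [rewrite Rabs_R0; lra|].
  eapply Rle_trans; [apply Rabs_triang|lra].
Qed.
End Sums.

Lemma Csum_exchange {I J : Type} (l : list I) (m : list J) (f : I -> J -> C) :
  Csum l (fun i => Csum m (fun j => f i j)) = Csum m (fun j => Csum l (fun i => f i j)).
Proof.
  induction l as [|x l IH]; simpl; [rewrite Csum_zero; reflexivity|].
  rewrite IH, Csum_add; reflexivity.
Qed.
Lemma Rsum_exchange {I J : Type} (l : list I) (m : list J) (f : I -> J -> R) :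
  Rsum l (fun i => Rsum m (fun j => f i j)) = Rsum m (fun j => Rsum l (fun i => f i j)).
Proof.
  induction l as [|x l IH]; simpl; [rewrite Rsum_const; ring|].
  rewrite IH, Rsum_add; reflexivity.
Qed.
Lemma Csum_map {I J : Type} (h : J -> I) (l : list J) (f : I -> C) :
  Csum (map h l) f = Csum l (fun j => f (h j)).
Proof. induction l as [|x l IH]; simpl; congruence. Qed.
Lemma Csum_flat_map {I J : Type} (h : J -> list I) (l : list J) (f : I -> C) :
  Csum (flat_map h l) f = Csum l (fun j => Csum (h j) f).
Proof. induction l as [|x l IH]; simpl; [reflexivity|]. rewrite Csum_app, IH; reflexivity. Qed.

Lemma Csum_nth {I : Type} (d : I) (l : list I) (f : I -> C) :
  Csum l f = Csum (seq 0 (length l)) (fun k => f (nth k l d)).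
Proof.
  rewrite <- Csum_map with (h := fun k => nth k l d).
  f_equal. induction l as [|x l IH]; simpl; [reflexivity|].
  f_equal. rewrite <- seq_shift, map_map. exact IH.
Qed.

Lemma Csum_enPair d1 d2 (f : nat * nat -> C) :
  Csum (enPair d1 d2) f = Csum (seq 0 d1) (fun x => Csum (seq 0 d2) (fun y => f (x, y))).
Proof.
  unfold enPair. rewrite Csum_flat_map. apply Csum_ext; intros x _. apply Csum_map.
Qed.
Lemma Csum_enABC dA dB dC (f : nat * nat * nat -> C) :
  Csum (enABC dA dB dC) f = Csum (seq 0 dA) (fun a => Csum (seq 0 dB) (fun b =>
    Csum (seq 0 dC) (fun c => f (a, b, c)))).
Proof.
  unfold enABC. rewrite Csum_flat_map. apply Csum_ext; intros a _.
  rewrite Csum_flat_map. apply Csum_ext; intros b _. apply Csum_map.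
Qed.

Lemma in_enPair d1 d2 x y :
  In (x, y) (enPair d1 d2) <-> In x (seq 0 d1) /\ In y (seq 0 d2).
Proof.
  unfold enPair. rewrite in_flat_map. split.
  - intros [x' [Hx H]]. apply in_map_iff in H. destruct H as [y' [E Hy]].
    injection E as <- <-; auto.
  - intros [Hx Hy]. exists x; split; [exact Hx|]. apply in_map_iff; exists y; auto.
Qed.
Lemma in_enABC dA dB dC a b c :
  In (a, b, c) (enABC dA dB dC) <->
  In a (seq 0 dA) /\ In b (seq 0 dB) /\ In c (seq 0 dC).
Proof.
  unfold enABC. rewrite in_flat_map. split.
  - intros [a' [Ha H]]. apply in_flat_map in H. destruct H as [b' [Hb H]].
    apply in_map_iff in H. destruct H as [c' [E Hc]]. injection E as <- <- <-; auto.
  - intros [Ha [Hb Hc]]. exists a; split; [exact Ha|]. apply in_flat_map.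
    exists b; split; [exact Hb|]. apply in_map_iff; exists c; auto.
Qed.

Lemma NoDup_flat_map_disjoint {I J : Type} (h : J -> list I) (p : I -> J) (l : list J) :
  NoDup l -> (forall j, NoDup (h j)) -> (forall j i, In i (h j) -> p i = j) ->
  NoDup (flat_map h l).
Proof.
  intros Hl Hh Hp. induction Hl as [|x l Hx Hl IH]; simpl; [constructor|].
  apply NoDup_app; auto. intros i Hi Hi'.
  apply in_flat_map in Hi'. destruct Hi' as [j [Hj Hij]].
  apply Hp in Hi; apply Hp in Hij; congruence.
Qed.
Lemma NoDup_enPair d1 d2 : NoDup (enPair d1 d2).
Proof.
  unfold enPair. apply NoDup_flat_map_disjoint with (p := fst).
  - apply seq_NoDup.
  - intros x. apply NoDup_map_NoDup_ForallPairs; [|apply seq_NoDup].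
    intros y y' _ _ E; congruence.
  - intros x i Hi. apply in_map_iff in Hi. destruct Hi as [y [<- _]]; reflexivity.
Qed.
Lemma NoDup_enABC dA dB dC : NoDup (enABC dA dB dC).
Proof.
  unfold enABC. apply NoDup_flat_map_disjoint with (p := tA).
  - apply seq_NoDup.
  - intros a. apply NoDup_flat_map_disjoint with (p := tB).
    + apply seq_NoDup.
    + intros b. apply NoDup_map_NoDup_ForallPairs; [|apply seq_NoDup].
      intros y y' _ _ E; congruence.
    + intros b i Hi. apply in_map_iff in Hi. destruct Hi as [y [<- _]]; reflexivity.
  - intros a i Hi. apply in_flat_map in Hi. destruct Hi as [b [_ Hi]].
    apply in_map_iff in Hi. destruct Hi as [y [<- _]]; reflexivity.
Qed.

(** * Operators on a listed index set and their eigensystems *)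

Definition Oadd {I} (X Y : Op I) : Op I := fun i j => Cadd (X i j) (Y i j).

Section Operators.
Context {I : Type}.
Implicit Types (l : list I) (X Y Z : Op I) (v w : Vec I).

(** The identity operator, decided classically because the index type is arbitrary. *)
Definition Odelta : Op I :=
  fun i j => if excluded_middle_informative (i = j) then Cone else Czero.
(** Restricted to listed indices because spectral constructions control nothing elsewhere:
    [Opow l X 0], for instance, is the identity only on [l]. *)
Definition Oeq l X Y : Prop := forall i j, In i l -> In j l -> X i j = Y i j.

Lemma Odelta_same i : Odelta i i = Cone.
Proof. unfold Odelta; destruct excluded_middle_informative; congruence. Qed.
Lemma Odelta_diff i j : i <> j -> Odelta i j = Czero.
Proof. unfold Odelta; destruct excluded_middle_informative; congruence. Qed.

Lemma Otr_ext l X Y : Oeq l X Y -> Otr l X = Otr l Y.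
Proof. intros H; apply Csum_ext; auto. Qed.

Lemma Omul_delta_l l X Y : NoDup l -> Oeq l X Odelta -> Oeq l (Omul l X Y) Y.
Proof.
  intros Hl HX i j Hi Hj. unfold Omul.
  rewrite (Csum_single l i); auto.
  - rewrite HX, Odelta_same by auto. ring.
  - intros k Hk Hne. rewrite HX, Odelta_diff by auto. ring.
Qed.
Lemma Omul_delta_r l X Y : NoDup l -> Oeq l Y Odelta -> Oeq l (Omul l X Y) X.
Proof.
  intros Hl HY i j Hi Hj. unfold Omul.
  rewrite (Csum_single l j); auto.
  - rewrite HY, Odelta_same by auto. ring.
  - intros k Hk Hne. rewrite HY, Odelta_diff by auto. ring.
Qed.

Lemma Omul_assoc l X Y Z : Omul l X (Omul l Y Z) = Omul l (Omul l X Y) Z.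
Proof.
  apply functional_extensionality; intros i; apply functional_extensionality; intros j.
  unfold Omul.
  rewrite (Csum_ext l _ (fun k => Csum l (fun m => Cmul (X i k) (Cmul (Y k m) (Z m j)))))
    by (intros; symmetry; apply Csum_mul_l).
  rewrite Csum_exchange. apply Csum_ext; intros m _.
  rewrite <- Csum_mul_r. apply Csum_ext; intros k _. ring.
Qed.
Lemma Otr_mul_comm l X Y : Otr l (Omul l X Y) = Otr l (Omul l Y X).
Proof.
  unfold Otr, Omul. rewrite Csum_exchange.
  apply Csum_ext; intros i _. apply Csum_ext; intros k _. ring.
Qed.

Lemma Otr_add l X Y : Otr l (Oadd X Y) = Cadd (Otr l X) (Otr l Y).
Proof. apply Csum_add. Qed.
Lemma Omul_add_r l X Y Z :
  Omul l X (Oadd Y Z) = Oadd (Omul l X Y) (Omul l X Z).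
Proof.
  apply functional_extensionality; intros i; apply functional_extensionality; intros j.
  unfold Oadd, Omul. rewrite <- Csum_add. apply Csum_ext; intros k _. ring.
Qed.

Definition quad l X v : R := Cre (inner l v (Oapp l X v)).

Lemma inner_app l X v w :
  inner l v (Oapp l X w) =
  Csum l (fun i => Csum l (fun j => Cmul (Cconj (v i)) (Cmul (X i j) (w j)))).
Proof. apply Csum_ext; intros i _; unfold Oapp; rewrite Csum_mul_l; reflexivity. Qed.
Lemma inner_ext l v v' w w' : (forall i, In i l -> v i = v' i) ->
  (forall i, In i l -> w i = w' i) -> inner l v w = inner l v' w'.
Proof. intros H H'; apply Csum_ext; intros i Hi; rewrite H, H'; auto. Qed.
Lemma inner_conj l v w : Cconj (inner l v w) = inner l w v.
Proof.
  unfold inner. rewrite Csum_conj. apply Csum_ext; intros i _.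
  rewrite Cconj_mul, Cconj_conj; ring.
Qed.

(** A functional form of [is_eigdecomp], detached from the chosen decomposition, so that it also
    applies to [Ofun l f X] with the eigenvectors of [X] and the eigenvalues [f (eigval l X k)]. *)
Record spectral_system l X (V : nat -> I -> C) (lam : nat -> R) : Prop := {
  sys_orth : forall k k', (k < length l)%nat -> (k' < length l)%nat ->
     inner l (V k) (V k') = if Nat.eq_dec k k' then Cone else Czero;
  sys_dec : forall i j, In i l -> In j l ->
     X i j = Csum (seq 0 (length l)) (fun k =>
        Cmul (RtoC (lam k)) (Cmul (V k i) (Cconj (V k j)))) }.

Lemma orthonormal_completeness l (V : nat -> I -> C) : NoDup l ->
  (forall k k', (k < length l)%nat -> (k' < length l)%nat ->
     inner l (V k) (V k') = if Nat.eq_dec k k' then Cone else Czero) ->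
  Oeq l (fun i j => Csum (seq 0 (length l)) (fun k => Cmul (V k i) (Cconj (V k j)))) Odelta.
Proof.
  intros Hl HV i j Hi Hj.
  destruct (In_nth l i i Hi) as [p [Hp Ep]].
  destruct (In_nth l j i Hj) as [q [Hq Eq]].
  pose proof (MatrixBridge.orthonormal_complete (length l) (fun k p => V k (nth p l i))) as H.
  assert (H1 : forall k k', (k < length l)%nat -> (k' < length l)%nat ->
    Csum (seq 0 (length l)) (fun p => Cmul (Cconj (V k (nth p l i))) (V k' (nth p l i)))
    = if Nat.eq_dec k k' then Cone else Czero).
  { intros k k' Hk Hk'. rewrite <- (HV k k') by auto. unfold inner.
    symmetry; apply (Csum_nth i l (fun x => Cmul (Cconj (V k x)) (V k' x))). }
  specialize (H H1 p q Hp Hq). simpl in H. rewrite Ep, Eq in H. rewrite H. unfold kronecker.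
  destruct (Nat.eq_dec p q) as [->|Hne].
  - rewrite Ep in Eq; subst j. symmetry; apply Odelta_same.
  - symmetry; apply Odelta_diff. intros E. apply Hne.
    apply (proj1 (NoDup_nth l i) Hl); congruence.
Qed.

Lemma hermitian_spectral l X : NoDup l -> hermitian l X ->
  exists vs lams, is_eigdecomp l X vs lams.
Proof.
  intros Hl HX. destruct l as [|d l'].
  - exists nil, nil. repeat split; simpl; intros; try lia; contradiction.
  - set (l := d :: l') in *.
    destruct (MatrixBridge.spectral_theorem (length l) (fun p q => X (nth p l d) (nth q l d)))
      as [V [lam [H1 H2]]].
    { intros p q Hp Hq. apply HX; apply nth_In; assumption. }
    (* [pos] inverts the enumeration [nth]; it is well defined on [l] because [l] has no
       repetitions. It carries eigenvectors indexed by positions back to the type [I]. *)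
    pose (pos := fun x => epsilon (inhabits O) (fun p => (p < length l)%nat /\ nth p l d = x)).
    assert (Hpos : forall x, In x l -> (pos x < length l)%nat /\ nth (pos x) l d = x).
    { intros x Hx. unfold pos. apply epsilon_spec.
      destruct (In_nth l x d Hx) as [p Hp]. exists p; exact Hp. }
    assert (Hpos' : forall p, (p < length l)%nat -> pos (nth p l d) = p).
    { intros p Hp. destruct (Hpos (nth p l d) (nth_In _ _ Hp)) as [A B].
      apply (proj1 (NoDup_nth l d) Hl); auto. }
    pose (W := (fun k x => V k (pos x)) : nat -> Vec I).
    exists (map W (seq 0 (length l))), (map lam (seq 0 (length l))).
    assert (EV : forall k, (k < length l)%nat ->
      nth k (map W (seq 0 (length l))) zerovec = W k).
    { intros k Hk.
      rewrite (nth_indep _ zerovec (W O)) by (rewrite length_map, length_seq; auto).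
      rewrite map_nth, seq_nth by auto; reflexivity. }
    assert (EL : forall k, (k < length l)%nat -> nth k (map lam (seq 0 (length l))) 0 = lam k).
    { intros k Hk.
      rewrite (nth_indep _ 0 (lam O)) by (rewrite length_map, length_seq; auto).
      rewrite map_nth, seq_nth by auto; reflexivity. }
    split; [rewrite length_map, length_seq; reflexivity|].
    split; [rewrite length_map, length_seq; reflexivity|]. split.
    + intros k k' Hk Hk'. change (if Nat.eq_dec k k' then Cone else Czero) with (kronecker k k'). rewrite <- H1 by auto. rewrite (EV k), (EV k') by auto.
      unfold inner. rewrite (Csum_nth d). apply Csum_ext; intros p Hp.
      apply in_seq in Hp. unfold W; rewrite Hpos' by lia. reflexivity.
    + intros i j Hi Hj. destruct (Hpos i Hi) as [Ai Bi], (Hpos j Hj) as [Aj Bj].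
      rewrite <- Bi at 1. rewrite <- Bj at 1. rewrite H2 by auto.
      apply Csum_ext; intros k Hk. apply in_seq in Hk.
      rewrite EV, EL by lia. reflexivity.
Qed.

Definition eigvec l X (k : nat) : Vec I := nth k (fst (eigdecomp l X)) zerovec.
Definition eigval l X (k : nat) : R := nth k (snd (eigdecomp l X)) 0.

(** Existence of a decomposition excludes the default branch [([], [])], so whatever choice returns
    is a genuine eigendecomposition. *)
Lemma eigdecomp_spec l X : NoDup l -> hermitian l X ->
  is_eigdecomp l X (fst (eigdecomp l X)) (snd (eigdecomp l X)).
Proof.
  intros Hl HX. unfold eigdecomp. destruct excluded_middle_informative as [H|H].
  - exact (proj2_sig (constructive_indefinite_description _ H)).
  - exfalso. destruct (hermitian_spectral l X Hl HX) as [vs [lams E]].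
    apply H. exists (vs, lams). exact E.
Qed.
Lemma eig_system l X : NoDup l -> hermitian l X ->
  spectral_system l X (eigvec l X) (eigval l X).
Proof.
  intros Hl HX. destruct (eigdecomp_spec l X Hl HX) as [_ [_ [H1 H2]]].
  split; [exact H1|exact H2].
Qed.

Lemma Ofun_eig l f X : Ofun l f X = (fun i j => Csum (seq 0 (length l)) (fun k =>
  Cmul (RtoC (f (eigval l X k))) (Cmul (eigvec l X k i) (Cconj (eigvec l X k j))))).
Proof. reflexivity. Qed.

Lemma vN_entropy_eig l X : NoDup l -> hermitian l X ->
  vN_entropy l X = - Rsum (seq 0 (length l)) (fun k => eta (eigval l X k)).
Proof.
  intros Hl HX. destruct (eigdecomp_spec l X Hl HX) as [_ [E _]].
  unfold vN_entropy. f_equal. rewrite <- E. unfold eigval.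
  generalize (snd (eigdecomp l X)) as s. clear.
  induction s as [|x s IH]; simpl; [reflexivity|].
  rewrite IH. f_equal. rewrite <- seq_shift. clear IH.
  generalize 0%nat, (length s). intros a n; revert a.
  induction n as [|n IHn]; intros a; simpl; [reflexivity|]. rewrite IHn; reflexivity.
Qed.

Lemma Otr_mul_Ofun l f X Y :
  Otr l (Omul l Y (Ofun l f X)) = Csum (seq 0 (length l)) (fun k =>
    Cmul (RtoC (f (eigval l X k))) (inner l (eigvec l X k) (Oapp l Y (eigvec l X k)))).
Proof.
  rewrite Ofun_eig. unfold Otr, Omul.
  rewrite (Csum_ext _ _ (fun i => Csum (seq 0 (length l)) (fun k => Csum l (fun j =>
    Cmul (RtoC (f (eigval l X k))) (Cmul (Cconj (eigvec l X k i)) (Cmul (Y i j) (eigvec l X k j))))))).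
  - rewrite Csum_exchange. apply Csum_ext; intros k _.
    rewrite inner_app, <- Csum_mul_l. apply Csum_ext; intros i _.
    rewrite <- Csum_mul_l. reflexivity.
  - intros i _. rewrite Csum_exchange. apply Csum_ext; intros j _.
    rewrite <- Csum_mul_l. apply Csum_ext; intros k _. ring.
Qed.

Section System.
Variables (l : list I) (X : Op I) (V : nat -> I -> C) (lam : nat -> R).
Hypotheses (Hl : NoDup l) (HS : spectral_system l X V lam).
Let n := length l.

Lemma sys_complete : Oeq l (fun i j => Csum (seq 0 n) (fun k => Cmul (V k i) (Cconj (V k j)))) Odelta.
Proof. apply orthonormal_completeness; [exact Hl|apply (sys_orth _ _ _ _ HS)]. Qed.

(** The trace may be computed in any orthonormal basis. [Y] is unrelated to [X]: later the
    eigenbasis of [sigma] evaluates the traces of [rho_BC] and of [T_a]. *)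
Lemma sys_trace Y : Csum (seq 0 n) (fun k => inner l (V k) (Oapp l Y (V k))) = Otr l Y.
Proof.
  rewrite (Csum_ext _ _ (fun k => Csum l (fun i => Csum l (fun j =>
    Cmul (Y i j) (Cmul (V k j) (Cconj (V k i))))))).
  - rewrite Csum_exchange. apply Csum_ext; intros i Hi.
    rewrite Csum_exchange. rewrite (Csum_single l i); auto.
    + rewrite Csum_mul_l. pose proof (sys_complete i i Hi Hi) as E; simpl in E.
      rewrite E, Odelta_same; ring.
    + intros j Hj Hne. rewrite Csum_mul_l. pose proof (sys_complete j i Hj Hi) as E; simpl in E.
      rewrite E, Odelta_diff by auto; ring.
  - intros k _. rewrite inner_app. apply Csum_ext; intros i _. apply Csum_ext; intros j _. ring.
Qed.

Lemma sys_inner_app v w :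
  inner l v (Oapp l X w) =
  Csum (seq 0 n) (fun k => Cmul (RtoC (lam k)) (Cmul (inner l v (V k)) (inner l (V k) w))).
Proof.
  rewrite inner_app.
  rewrite (Csum_ext _ _ (fun i => Csum (seq 0 n) (fun k => Csum l (fun j =>
    Cmul (RtoC (lam k)) (Cmul (Cmul (Cconj (v i)) (V k i)) (Cmul (Cconj (V k j)) (w j))))))).
  - rewrite Csum_exchange. apply Csum_ext; intros k _. unfold inner.
    rewrite <- Csum_mul_r, <- Csum_mul_l. apply Csum_ext; intros i _.
    rewrite <- 2 Csum_mul_l. reflexivity.
  - intros i Hi. rewrite Csum_exchange. apply Csum_ext; intros j Hj.
    rewrite (sys_dec _ _ _ _ HS) by auto. rewrite <- Csum_mul_r, <- Csum_mul_l.
    apply Csum_ext; intros k _. ring.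
Qed.

Lemma sys_eigval k : (k < n)%nat -> inner l (V k) (Oapp l X (V k)) = RtoC (lam k).
Proof.
  intros Hk. rewrite sys_inner_app. rewrite (Csum_single _ k).
  - rewrite (sys_orth _ _ _ _ HS) by auto. destruct Nat.eq_dec; [ring|congruence].
  - apply seq_NoDup.
  - apply in_seq; lia.
  - intros j Hj Hne. apply in_seq in Hj. rewrite (sys_orth _ _ _ _ HS) by (auto; lia).
    destruct Nat.eq_dec; [congruence|ring].
Qed.

Lemma sys_parseval v : inner l v v = RtoC (Rsum (seq 0 n) (fun k => Cnorm2 (inner l (V k) v))).
Proof.
  (* Insert the resolution of the identity given by [sys_complete]. *)
  transitivity (inner l v (Oapp l (fun i j => Csum (seq 0 n) (fun k => Cmul (V k i) (Cconj (V k j)))) v)).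
  - apply Csum_ext; intros i Hi. f_equal. unfold Oapp.
    rewrite (Csum_single l i); auto.
    + rewrite sys_complete, Odelta_same by auto. ring.
    + intros j Hj Hne. rewrite sys_complete, Odelta_diff by auto. ring.
  - rewrite inner_app.
    rewrite (Csum_ext _ _ (fun i => Csum (seq 0 n) (fun k => Csum l (fun j =>
      Cmul (Cmul (Cconj (v i)) (V k i)) (Cmul (Cconj (V k j)) (v j)))))).
    + rewrite Csum_exchange.
      rewrite (Csum_ext _ _ (fun k => RtoC (Cnorm2 (inner l (V k) v)))).
      * generalize (seq 0 n) as s. induction s as [|k s IH]; simpl; [reflexivity|].
        rewrite IH. apply C_eq; simpl; ring.
      * intros k _. rewrite <- Cmul_conj, inner_conj. unfold inner.
        rewrite <- Csum_mul_r. apply Csum_ext; intros i _. rewrite Csum_mul_l. reflexivity.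
    + intros i _. rewrite Csum_exchange. apply Csum_ext; intros j _.
      rewrite <- Csum_mul_r, <- Csum_mul_l. apply Csum_ext; intros k _. ring.
Qed.

Lemma sys_quad v : quad l X v = Rsum (seq 0 n) (fun k => lam k * Cnorm2 (inner l (V k) v)).
Proof.
  unfold quad. rewrite sys_inner_app, Cre_Csum. apply Rsum_ext; intros k _.
  rewrite <- (inner_conj l (V k) v), Cmul_conj, Cre_scale. reflexivity.
Qed.

Lemma sys_trace_val : Otr l X = RtoC (Rsum (seq 0 n) lam).
Proof.
  rewrite <- sys_trace.
  rewrite (Csum_ext _ _ (fun k => RtoC (lam k))).
  - generalize (seq 0 n) as s. induction s as [|k s IH]; simpl; [reflexivity|].
    rewrite IH. apply C_eq; simpl; ring.
  - intros k Hk. apply in_seq in Hk. apply sys_eigval. lia.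
Qed.

Lemma sys_nonzero k : (k < n)%nat -> exists i, In i l /\ V k i <> Czero.
Proof.
  intros Hk. apply NNPP. intros H.
  pose proof (sys_orth _ _ _ _ HS k k Hk Hk) as E.
  destruct Nat.eq_dec as [_|]; [|congruence].
  unfold inner in E. rewrite (Csum_ext _ _ (fun _ => Czero)), Csum_zero in E.
  - injection E; lra.
  - intros i Hi. destruct (excluded_middle_informative (V k i = Czero)) as [->|Hn]; [ring|].
    exfalso; apply H; exists i; auto.
Qed.

Lemma sys_posdef k : posdef l X -> (k < n)%nat -> 0 < lam k.
Proof.
  intros [_ H] Hk. specialize (H (V k) (sys_nonzero k Hk)).
  rewrite sys_eigval in H by exact Hk. exact H.
Qed.
Lemma sys_psd k : psd l X -> (k < n)%nat -> 0 <= lam k.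
Proof.
  intros [_ H] Hk. specialize (H (V k)). rewrite sys_eigval in H by exact Hk. exact H.
Qed.
End System.

Lemma Ofun_id l f X : NoDup l -> hermitian l X ->
  (forall k, (k < length l)%nat -> f (eigval l X k) = eigval l X k) -> Oeq l (Ofun l f X) X.
Proof.
  intros Hl HX Hf i j Hi Hj. rewrite Ofun_eig.
  rewrite (sys_dec _ _ _ _ (eig_system l X Hl HX) i j Hi Hj).
  apply Csum_ext; intros k Hk. apply in_seq in Hk. rewrite Hf by lia. reflexivity.
Qed.
Lemma Ofun_one l f X : NoDup l -> hermitian l X ->
  (forall k, (k < length l)%nat -> f (eigval l X k) = 1) -> Oeq l (Ofun l f X) Odelta.
Proof.
  intros Hl HX Hf i j Hi Hj. rewrite Ofun_eig.
  rewrite <- (sys_complete l X _ _ Hl (eig_system l X Hl HX) i j Hi Hj).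
  apply Csum_ext; intros k Hk. apply in_seq in Hk. rewrite Hf by lia.
  apply C_eq; simpl; ring.
Qed.

End Operators.

(** * Partial traces *)

(** The witness is [X^-1 u] expanded in the eigenbasis: the coefficient along [V m] is
    [<V m, u> / lam m]. *)
Lemma sys_solve {I} (l : list I) X V lam : NoDup l -> spectral_system l X V lam ->
  (forall k, (k < length l)%nat -> lam k <> 0) ->
  forall u : Vec I, exists w : Vec I, forall i, In i l -> Oapp l X w i = u i.
Proof.
  intros Hl HS Hlam u.
  set (n := length l).
  exists (fun i => Csum (seq 0 n) (fun m => Cmul (Cmul (RtoC (/ lam m)) (inner l (V m) u)) (V m i))).
  intros i Hi.
  assert (Hw : forall k, (k < n)%nat -> inner l (V k) (fun i => Csum (seq 0 n) (fun m =>
    Cmul (Cmul (RtoC (/ lam m)) (inner l (V m) u)) (V m i))) = Cmul (RtoC (/ lam k)) (inner l (V k) u)).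
  { intros k Hk. unfold inner at 1.
    rewrite (Csum_ext _ _ (fun j => Csum (seq 0 n) (fun m =>
      Cmul (Cmul (RtoC (/ lam m)) (inner l (V m) u)) (Cmul (Cconj (V k j)) (V m j))))).
    - rewrite Csum_exchange.
      rewrite (Csum_single _ k); [| apply seq_NoDup | apply in_seq; lia |].
      + rewrite Csum_mul_l. fold (inner l (V k) (V k)).
        rewrite (sys_orth _ _ _ _ HS) by auto. destruct Nat.eq_dec; [ring|congruence].
      + intros m Hm Hne. apply in_seq in Hm. rewrite Csum_mul_l. fold (inner l (V k) (V m)).
        rewrite (sys_orth _ _ _ _ HS) by (auto; lia). destruct Nat.eq_dec; [congruence|ring].
    - intros j _. rewrite <- Csum_mul_l. apply Csum_ext; intros m _. ring. }
  set (w := fun i => Csum (seq 0 n) _) in *.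
  unfold Oapp.
  rewrite (Csum_ext _ _ (fun j => Csum (seq 0 n) (fun k =>
    Cmul (Cmul (RtoC (lam k)) (V k i)) (Cmul (Cconj (V k j)) (w j))))).
  - rewrite Csum_exchange.
    rewrite (Csum_ext _ _ (fun k => Csum l (fun j => Cmul (Cmul (V k i) (Cconj (V k j))) (u j)))).
    + rewrite Csum_exchange. rewrite (Csum_single l i); auto.
      * rewrite Csum_mul_r. pose proof (sys_complete l X V lam Hl HS i i Hi Hi) as E; simpl in E.
        unfold n; rewrite E, Odelta_same; ring.
      * intros j Hj Hne. rewrite Csum_mul_r.
        pose proof (sys_complete l X V lam Hl HS i j Hi Hj) as E; simpl in E.
        unfold n; rewrite E, Odelta_diff by auto; ring.
    + intros k Hk. apply in_seq in Hk. rewrite Csum_mul_l. fold (inner l (V k) w).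
      rewrite Hw by lia. unfold inner. rewrite <- 2 Csum_mul_l.
      apply Csum_ext; intros j _.
      assert (E : Cmul (RtoC (lam k)) (RtoC (/ lam k)) = Cone).
      { apply C_eq; simpl; [|ring]. field_simplify; [ring|apply Hlam; lia]. }
      transitivity (Cmul (Cmul (RtoC (lam k)) (RtoC (/ lam k)))
        (Cmul (Cmul (V k i) (Cconj (V k j))) (u j))); [ring|rewrite E; ring].
  - intros j Hj. rewrite (sys_dec _ _ _ _ HS) by auto. rewrite <- Csum_mul_r.
    apply Csum_ext; intros k _. ring.
Qed.

(* Abstract tensor splitting [I ~ E * K]: [marg] traces out [E] and [lift] tensors with the identity on [E]. *)
Record partial_trace {I K E : Type} (L : list I) (lk : list K) (le : list E)
    (phi : E -> K -> I) (pe : I -> E) (pk : I -> K)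
    (marg : Op I -> Op K) (lift : Op K -> Op I) : Prop := {
  pt_sum : forall f, Csum L f = Csum le (fun e => Csum lk (fun k => f (phi e k)));
  pt_lift : forall Y e k e' k', lift Y (phi e k) (phi e' k') =
    if excluded_middle_informative (e = e') then Y k k' else Czero;
  pt_marg : forall M k k', marg M k k' = Csum le (fun e => M (phi e k) (phi e k'));
  pt_nodup : NoDup le;
  pt_pe : forall e k, pe (phi e k) = e;
  pt_pk : forall e k, pk (phi e k) = k;
  pt_phi : forall i, phi (pe i) (pk i) = i;
  pt_in : forall e k, In (phi e k) L <-> In e le /\ In k lk }.

Section PartialTrace.
Context {I K E : Type} {L : list I} {lk : list K} {le : list E}
  {phi : E -> K -> I} {pe : I -> E} {pk : I -> K}
  {marg : Op I -> Op K} {lift : Op K -> Op I}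
  (PT : partial_trace L lk le phi pe pk marg lift).

Lemma pt_in_L i : In i L <-> In (pe i) le /\ In (pk i) lk.
Proof. rewrite <- (pt_in _ _ _ _ _ _ _ _ PT), (pt_phi _ _ _ _ _ _ _ _ PT); reflexivity. Qed.

Lemma lift_at Y i j : lift Y i j =
  if excluded_middle_informative (pe i = pe j) then Y (pk i) (pk j) else Czero.
Proof.
  rewrite <- (pt_phi _ _ _ _ _ _ _ _ PT i) at 1. rewrite <- (pt_phi _ _ _ _ _ _ _ _ PT j) at 1.
  apply (pt_lift _ _ _ _ _ _ _ _ PT).
Qed.

Lemma lift_delta Y : Oeq lk Y Odelta -> Oeq L (lift Y) Odelta.
Proof.
  intros HY i j Hi Hj. apply pt_in_L in Hi; apply pt_in_L in Hj.
  rewrite lift_at. destruct excluded_middle_informative as [He|He].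
  - rewrite HY by tauto. unfold Odelta.
    destruct excluded_middle_informative as [Hk|Hk], excluded_middle_informative as [Hij|Hij];
      try reflexivity; exfalso; [|apply Hk; congruence].
    apply Hij. rewrite <- (pt_phi _ _ _ _ _ _ _ _ PT i), He, Hk. apply (pt_phi _ _ _ _ _ _ _ _ PT).
  - symmetry; apply Odelta_diff. congruence.
Qed.

Lemma marg_tr M : Otr lk (marg M) = Otr L M.
Proof.
  unfold Otr. rewrite (pt_sum _ _ _ _ _ _ _ _ PT), Csum_exchange.
  apply Csum_ext; intros k _. apply (pt_marg _ _ _ _ _ _ _ _ PT).
Qed.

(** Partial trace is adjoint to tensoring with the identity: the lift is block diagonal in [E], so
    only the blocks of [M] with equal [E]-indices contribute. *)
Lemma tr_mul_lift M Y : Otr L (Omul L M (lift Y)) = Otr lk (Omul lk (marg M) Y).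
Proof.
  unfold Otr, Omul. rewrite (pt_sum _ _ _ _ _ _ _ _ PT).
  rewrite (Csum_ext le _ (fun e => Csum lk (fun k => Csum lk (fun k' =>
    Cmul (M (phi e k) (phi e k')) (Y k' k))))).
  - rewrite Csum_exchange. apply Csum_ext; intros k _.
    rewrite Csum_exchange. apply Csum_ext; intros k' _.
    rewrite Csum_mul_r, (pt_marg _ _ _ _ _ _ _ _ PT). reflexivity.
  - intros e He. apply Csum_ext; intros k Hk. rewrite (pt_sum _ _ _ _ _ _ _ _ PT).
    rewrite (Csum_single le e); [|apply (pt_nodup _ _ _ _ _ _ _ _ PT)|exact He|].
    + apply Csum_ext; intros k' _. rewrite (pt_lift _ _ _ _ _ _ _ _ PT).
      destruct excluded_middle_informative; [reflexivity|congruence].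
    + intros e' He' Hne. rewrite (Csum_ext _ _ (fun _ => Czero)), Csum_zero; [reflexivity|].
      intros k' _. rewrite (pt_lift _ _ _ _ _ _ _ _ PT).
      destruct excluded_middle_informative; [congruence|ring].
Qed.

(** The product of the basis vector at [e] with [v]. *)
Definition embed (e : E) (v : Vec K) : Vec I :=
  fun i => if excluded_middle_informative (pe i = e) then v (pk i) else Czero.

Lemma embed_phi e v e' k : embed e v (phi e' k) =
  if excluded_middle_informative (e' = e) then v k else Czero.
Proof.
  unfold embed. rewrite (pt_pe _ _ _ _ _ _ _ _ PT), (pt_pk _ _ _ _ _ _ _ _ PT). reflexivity.
Qed.

Lemma inner_embed e v u : In e le ->
  inner L (embed e v) u = inner lk v (fun k => u (phi e k)).
Proof.
  intros He. unfold inner. rewrite (pt_sum _ _ _ _ _ _ _ _ PT).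
  rewrite (Csum_single le e); [|apply (pt_nodup _ _ _ _ _ _ _ _ PT)|exact He|].
  - apply Csum_ext; intros k _. rewrite embed_phi.
    destruct excluded_middle_informative; [reflexivity|congruence].
  - intros e' He' Hne. rewrite (Csum_ext _ _ (fun _ => Czero)), Csum_zero; [reflexivity|].
    intros k' _. rewrite embed_phi.
    destruct excluded_middle_informative; [congruence|rewrite Cconj_zero; ring].
Qed.

Lemma Oapp_embed M e v i : In e le ->
  Oapp L M (embed e v) i = Csum lk (fun k => Cmul (M i (phi e k)) (v k)).
Proof.
  intros He. unfold Oapp. rewrite (pt_sum _ _ _ _ _ _ _ _ PT).
  rewrite (Csum_single le e); [|apply (pt_nodup _ _ _ _ _ _ _ _ PT)|exact He|].
  - apply Csum_ext; intros k _. rewrite embed_phi.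
    destruct excluded_middle_informative; [reflexivity|congruence].
  - intros e' He' Hne. rewrite (Csum_ext _ _ (fun _ => Czero)), Csum_zero; [reflexivity|].
    intros k' _. rewrite embed_phi.
    destruct excluded_middle_informative; [congruence|ring].
Qed.

Lemma Oapp_lift Y w e k : In e le ->
  Oapp L (lift Y) w (phi e k) = Oapp lk Y (fun k' => w (phi e k')) k.
Proof.
  intros He. unfold Oapp. rewrite (pt_sum _ _ _ _ _ _ _ _ PT).
  rewrite (Csum_single le e); [|apply (pt_nodup _ _ _ _ _ _ _ _ PT)|exact He|].
  - apply Csum_ext; intros k' _. rewrite (pt_lift _ _ _ _ _ _ _ _ PT).
    destruct excluded_middle_informative; [reflexivity|congruence].
  - intros e' He' Hne. rewrite (Csum_ext _ _ (fun _ => Czero)), Csum_zero; [reflexivity|].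
    intros k' _. rewrite (pt_lift _ _ _ _ _ _ _ _ PT).
    destruct excluded_middle_informative; [congruence|ring].
Qed.

Lemma marg_quad M v : quad lk (marg M) v = Rsum le (fun e => quad L M (embed e v)).
Proof.
  unfold quad. rewrite <- Cre_Csum. f_equal. rewrite inner_app.
  rewrite (Csum_ext le _ (fun e => Csum lk (fun k => Csum lk (fun k' =>
    Cmul (Cconj (v k)) (Cmul (M (phi e k) (phi e k')) (v k')))))).
  - symmetry. rewrite Csum_exchange. apply Csum_ext; intros k _.
    rewrite Csum_exchange. apply Csum_ext; intros k' _.
    rewrite Csum_mul_l, Csum_mul_r, (pt_marg _ _ _ _ _ _ _ _ PT). reflexivity.
  - intros e He. rewrite inner_embed by exact He. unfold inner.
    apply Csum_ext; intros k Hk. rewrite Oapp_embed, <- Csum_mul_l by exact He. reflexivity.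
Qed.

Lemma marg_hermitian M : hermitian L M -> hermitian lk (marg M).
Proof.
  intros H k k' Hk Hk'. rewrite 2 (pt_marg _ _ _ _ _ _ _ _ PT), Csum_conj.
  apply Csum_ext; intros e He. apply H; apply (pt_in _ _ _ _ _ _ _ _ PT); auto.
Qed.

(** By [marg_quad] the form of the marginal at [v] is a sum over [e] of the form of [M] at the
    product vectors [embed e v]. Each term is positive, and [le] nonempty makes the sum positive. *)
Lemma marg_posdef M : le <> nil -> posdef L M -> posdef lk (marg M).
Proof.
  intros Hne [Hh Hp]. split; [apply marg_hermitian; exact Hh|].
  intros v [k [Hk Hv]]. change (0 < quad lk (marg M) v). rewrite marg_quad.
  apply Rsum_pos; [exact Hne|]. intros e He. apply Hp.
  exists (phi e k). split; [apply (pt_in _ _ _ _ _ _ _ _ PT); auto|].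
  rewrite embed_phi. destruct excluded_middle_informative; [exact Hv|congruence].
Qed.

Lemma supp_incl_lift M X : NoDup lk -> posdef lk X -> supp_incl L M (lift X).
Proof.
  intros Hl HX v.
  pose proof (eig_system lk X Hl (proj1 HX)) as HS.
  assert (Hs : forall k, (k < length lk)%nat -> eigval lk X k <> 0).
  { intros k Hk. pose proof (sys_posdef lk X _ _ HS k HX Hk). lra. }
  pose proof (sys_solve lk X _ _ Hl HS Hs) as Hsolve.
  (* The equation decouples over [E]: choose one solution in each slice and glue them together. *)
  pose (W := fun e => epsilon (inhabits (zerovec : Vec K)) (fun w => forall k, In k lk ->
    Oapp lk X w k = Oapp L M v (phi e k))).
  exists (fun i => W (pe i) (pk i)). intros i Hi. apply pt_in_L in Hi.
  rewrite <- (pt_phi _ _ _ _ _ _ _ _ PT i). rewrite Oapp_lift by tauto.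
  assert (HW : forall k, In k lk -> Oapp lk X (W (pe i)) k = Oapp L M v (phi (pe i) k)).
  { unfold W. apply epsilon_spec. apply (Hsolve (fun k => Oapp L M v (phi (pe i) k))). }
  rewrite <- HW by tauto. apply Csum_ext; intros k _.
  rewrite (pt_pe _ _ _ _ _ _ _ _ PT), (pt_pk _ _ _ _ _ _ _ _ PT). reflexivity.
Qed.

(** Let [v] be an eigenvector of [X] with eigenvalue [0]. Support inclusion writes [M (embed e v)]
    as [lift X] applied to some [w], and pairing with [embed e v] gives [<v, X w_e> = 0], against
    positivity of [M]. Hence every admissible [sigma] has strictly positive eigenvalues, and [pw]
    takes its [Rpower] branch on them. *)
Lemma supp_incl_eigval_pos M X k : NoDup lk -> le <> nil -> posdef L M -> psd lk X ->
  supp_incl L M (lift X) -> (k < length lk)%nat -> 0 < eigval lk X k.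
Proof.
  intros Hl Hne HM HX Hsupp Hk.
  pose proof (eig_system lk X Hl (proj1 HX)) as HS.
  destruct (Rle_lt_or_eq_dec _ _ (sys_psd lk X _ _ HS k HX Hk)) as [H|H]; [exact H|exfalso].
  destruct le as [|e le'] eqn:Ele; [congruence|].
  assert (He : In e le) by (rewrite Ele; left; reflexivity).
  rewrite <- Ele in *.
  destruct (Hsupp (embed e (eigvec lk X k))) as [w Hw].
  assert (Hpos : 0 < Cre (inner L (embed e (eigvec lk X k)) (Oapp L M (embed e (eigvec lk X k))))).
  { apply (proj2 HM). destruct (sys_nonzero lk X _ _ HS k Hk) as [i [Hi Hvi]].
    exists (phi e i). split; [apply (pt_in _ _ _ _ _ _ _ _ PT); auto|].
    rewrite embed_phi. destruct excluded_middle_informative; [exact Hvi|congruence]. }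
  rewrite (inner_ext L _ _ _ _ (fun i _ => eq_refl) Hw) in Hpos.
  rewrite inner_embed in Hpos by exact He.
  rewrite (inner_ext lk _ (eigvec lk X k) _ (Oapp lk X (fun k' => w (phi e k')))) in Hpos;
    [|reflexivity|intros; apply Oapp_lift; exact He].
  rewrite (sys_inner_app lk X _ _ HS) in Hpos.
  rewrite (Csum_ext _ _ (fun _ => Czero)), Csum_zero in Hpos; [simpl in Hpos; lra|].
  intros m Hm. apply in_seq in Hm. destruct (Nat.eq_dec k m) as [<-|Hkm].
  - rewrite <- H. apply C_eq; simpl; ring.
  - rewrite (sys_orth _ _ _ _ HS) by (auto; lia). destruct Nat.eq_dec; [congruence|ring].
Qed.
End PartialTrace.

(** * The three marginals as instances of the abstract splitting *)

Lemma kd_em (m n : nat) (A : Type) (x y : A) :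
  (if kd m n then x else y) = if excluded_middle_informative (m = n) then x else y.
Proof.
  unfold kd. destruct (Nat.eqb_spec m n), excluded_middle_informative; congruence.
Qed.

Lemma partial_trace_AC dA dB dC :
  partial_trace (enABC dA dB dC) (enPair dA dC) (seq 0 dB)
    (fun b x => (fst x, b, snd x)) tB (fun i => (tA i, tC i)) (margAC dB) liftAC.
Proof.
  split.
  - intros f. rewrite Csum_enABC.
    rewrite (Csum_ext (seq 0 dB) _ (fun b => Csum (seq 0 dA) (fun a => Csum (seq 0 dC) (fun c => f (a, b, c)))))
      by (intros b _; apply Csum_enPair).
    apply Csum_exchange.
  - intros Y b x b' y. unfold liftAC, tA, tB, tC; simpl. rewrite kd_em.
    destruct x, y; reflexivity.
  - reflexivity.
  - apply seq_NoDup.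
  - reflexivity.
  - intros b [a c]; reflexivity.
  - intros [[a b] c]; reflexivity.
  - intros b [a c]; simpl. rewrite in_enABC, in_enPair. tauto.
Qed.

Lemma partial_trace_BC dA dB dC :
  partial_trace (enABC dA dB dC) (enPair dB dC) (seq 0 dA)
    (fun a x => (a, fst x, snd x)) tA (fun i => (tB i, tC i)) (margBC dA) liftBC.
Proof.
  split.
  - intros f. rewrite Csum_enABC. apply Csum_ext; intros a _.
    symmetry; apply Csum_enPair.
  - intros Y b x b' y. unfold liftBC, tA, tB, tC; simpl. rewrite kd_em.
    destruct x, y; reflexivity.
  - reflexivity.
  - apply seq_NoDup.
  - reflexivity.
  - intros b [a c]; reflexivity.
  - intros [[a b] c]; reflexivity.
  - intros b [a c]; simpl. rewrite in_enABC, in_enPair. tauto.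
Qed.

Lemma partial_trace_C dA dB dC :
  partial_trace (enABC dA dB dC) (enA dC) (enPair dA dB)
    (fun x c => (fst x, snd x, c)) (fun i => (tA i, tB i)) tC (margC dA dB) liftC.
Proof.
  split.
  - intros f. rewrite Csum_enABC, Csum_enPair. reflexivity.
  - intros Y [a b] c [a' b'] c'. unfold liftC, tA, tB, tC, kd; simpl.
    destruct (Nat.eqb_spec a a'), (Nat.eqb_spec b b'), excluded_middle_informative;
      simpl; congruence.
  - intros M c c'. rewrite Csum_enPair. reflexivity.
  - apply NoDup_enPair.
  - intros [a b] c; reflexivity.
  - reflexivity.
  - intros [[a b] c]; reflexivity.
  - intros [a b] c; simpl. rewrite in_enABC, in_enPair. unfold enA. tauto.
Qed.

(** * Derivatives at 1 and uniform estimates *)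

Lemma derivable_pt_lim_eq f x d d' : derivable_pt_lim f x d -> d = d' -> derivable_pt_lim f x d'.
Proof. intros H <-; exact H. Qed.

Definition Cderiv (f : R -> C) (d : C) : Prop :=
  derivable_pt_lim (fun a => Cre (f a)) 1 (Cre d) /\
  derivable_pt_lim (fun a => Cim (f a)) 1 (Cim d).

Lemma Cderiv_const c : Cderiv (fun _ => c) Czero.
Proof. split; simpl; apply derivable_pt_lim_const. Qed.
Lemma Cderiv_add f g f' g' : Cderiv f f' -> Cderiv g g' ->
  Cderiv (fun a => Cadd (f a) (g a)) (Cadd f' g').
Proof.
  intros [H1 H2] [H3 H4]; split; simpl.
  - apply (derivable_pt_lim_plus (fun a => Cre (f a)) (fun a => Cre (g a))); auto.
  - apply (derivable_pt_lim_plus (fun a => Cim (f a)) (fun a => Cim (g a))); auto.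
Qed.
Lemma Cderiv_mul f g f' g' : Cderiv f f' -> Cderiv g g' ->
  Cderiv (fun a => Cmul (f a) (g a)) (Cadd (Cmul f' (g 1)) (Cmul (f 1) g')).
Proof.
  intros [H1 H2] [H3 H4]; split; simpl.
  - eapply derivable_pt_lim_eq.
    + apply (derivable_pt_lim_minus (fun a => Cre (f a) * Cre (g a)) (fun a => Cim (f a) * Cim (g a))).
      * apply (derivable_pt_lim_mult (fun a => Cre (f a)) (fun a => Cre (g a))); eassumption.
      * apply (derivable_pt_lim_mult (fun a => Cim (f a)) (fun a => Cim (g a))); eassumption.
    + ring.
  - eapply derivable_pt_lim_eq.
    + apply (derivable_pt_lim_plus (fun a => Cre (f a) * Cim (g a)) (fun a => Cim (f a) * Cre (g a))).
      * apply (derivable_pt_lim_mult (fun a => Cre (f a)) (fun a => Cim (g a))); eassumption.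
      * apply (derivable_pt_lim_mult (fun a => Cim (f a)) (fun a => Cre (g a))); eassumption.
    + ring.
Qed.
Lemma Cderiv_sum {I} (l : list I) (f : R -> I -> C) (f' : I -> C) :
  (forall i, In i l -> Cderiv (fun a => f a i) (f' i)) ->
  Cderiv (fun a => Csum l (f a)) (Csum l f').
Proof.
  induction l as [|x l IH]; intros H; simpl; [apply Cderiv_const|].
  apply (Cderiv_add (fun a => f a x) (fun a => Csum l (f a))); [apply H; simpl; auto|].
  apply IH; intros; apply H; simpl; auto.
Qed.

(** First-order data at [a = 1]. The value [F1] is a separate argument because it is known only
    entrywise on [l]: stating it as [Odelta] or [rho], instead of [F 1], lets products simplify. *)
Definition tangent {I} (l : list I) (F : R -> Op I) (F1 F' : Op I) : Prop :=
  forall i j, In i l -> In j l -> F 1 i j = F1 i j /\ Cderiv (fun a => F a i j) (F' i j).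

Section Tangent.
Context {I : Type}.
Variable l : list I.
Hypothesis Hl : NoDup l.

Lemma tangent_ext F F1 F2 F' F'' : tangent l F F1 F' -> Oeq l F1 F2 -> Oeq l F' F'' ->
  tangent l F F2 F''.
Proof. intros H E E' i j Hi Hj. rewrite <- E, <- E' by auto. auto. Qed.

Lemma tangent_mul F G F1 G1 F' G' : tangent l F F1 F' -> tangent l G G1 G' ->
  tangent l (fun a => Omul l (F a) (G a)) (Omul l F1 G1) (Oadd (Omul l F' G1) (Omul l F1 G')).
Proof.
  intros HF HG i j Hi Hj. split.
  - apply Csum_ext; intros k Hk. destruct (HF i k Hi Hk) as [-> _], (HG k j Hk Hj) as [-> _]. reflexivity.
  - unfold Oadd, Omul. rewrite <- Csum_add. apply Cderiv_sum. intros k Hk.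
    destruct (HF i k Hi Hk) as [<- H1], (HG k j Hk Hj) as [<- H2].
    apply (Cderiv_mul (fun a => F a i k) (fun a => G a k j)); auto.
Qed.

(** At [a = 1] every factor of the Renyi trace except [rho^a] is the identity. The product rule
    therefore collapses to a sum with a single product per term, and no commutator appears. *)
Lemma tangent_mul_id_r F G F1 F' G' : tangent l F F1 F' -> tangent l G Odelta G' ->
  tangent l (fun a => Omul l (F a) (G a)) F1 (Oadd F' (Omul l F1 G')).
Proof.
  intros HF HG. eapply tangent_ext; [exact (tangent_mul _ _ _ _ _ _ HF HG)| |].
  - apply Omul_delta_r; [exact Hl|intros i j _ _; reflexivity].
  - intros i j Hi Hj. unfold Oadd. f_equal. apply Omul_delta_r; auto. intros ? ? _ _; reflexivity.
Qed.
Lemma tangent_mul_id_l F G G1 F' G' : tangent l F Odelta F' -> tangent l G G1 G' ->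
  tangent l (fun a => Omul l (F a) (G a)) G1 (Oadd (Omul l F' G1) G').
Proof.
  intros HF HG. eapply tangent_ext; [exact (tangent_mul _ _ _ _ _ _ HF HG)| |].
  - apply Omul_delta_l; [exact Hl|intros i j _ _; reflexivity].
  - intros i j Hi Hj. unfold Oadd. f_equal. apply Omul_delta_l; auto. intros ? ? _ _; reflexivity.
Qed.
Lemma tangent_mul_id F G F' G' : tangent l F Odelta F' -> tangent l G Odelta G' ->
  tangent l (fun a => Omul l (F a) (G a)) Odelta (Oadd F' G').
Proof.
  intros HF HG. eapply tangent_ext; [exact (tangent_mul_id_r _ _ _ _ _ HF HG)| |].
  - intros ? ? _ _; reflexivity.
  - intros i j Hi Hj. unfold Oadd. f_equal. apply Omul_delta_l; auto. intros ? ? _ _; reflexivity.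
Qed.
Lemma tangent_tr F F1 F' : tangent l F F1 F' -> Cderiv (fun a => Otr l (F a)) (Otr l F').
Proof. intros H. apply (Cderiv_sum l (fun a i => F a i i)). intros i Hi. apply H; auto. Qed.

(** Only the exponent moves, so each spectral coefficient is differentiated as [exp (e a * ln x)]
    while the eigenvectors stay constant; positive definiteness gives [x > 0]. *)
Lemma tangent_Opow X (e : R -> R) e' : posdef l X -> derivable_pt_lim e 1 e' ->
  tangent l (fun a => Opow l X (e a)) (Opow l X (e 1))
    (Ofun l (fun x => e' * ln x * pw (e 1) x) X).
Proof.
  intros HX He i j Hi Hj. split; [reflexivity|].
  unfold Opow. rewrite Ofun_eig.
  apply (Cderiv_sum _ (fun a k => Cmul (RtoC (pw (e a) (eigval l X k)))
    (Cmul (eigvec l X k i) (Cconj (eigvec l X k j))))).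
  intros k Hk. apply in_seq in Hk.
  pose proof (sys_posdef l X _ _ (eig_system l X Hl (proj1 HX)) k HX ltac:(lia)) as Hpos.
  set (x := eigval l X k) in *. set (c := Cmul _ (Cconj _)).
  assert (H : Cderiv (fun a => RtoC (pw (e a) x)) (RtoC (e' * ln x * pw (e 1) x))).
  { split; simpl; [|apply derivable_pt_lim_const].
    unfold pw. destruct (Rlt_dec 0 x); [|lra]. unfold Rpower.
    eapply derivable_pt_lim_eq.
    - apply (derivable_pt_lim_comp (fun a => e a * ln x) exp).
      + apply (derivable_pt_lim_mult e (fun _ => ln x)); [exact He|apply derivable_pt_lim_const].
      + apply derivable_pt_lim_exp.
    - simpl. ring. }
  pose proof (Cderiv_mul _ _ _ _ H (Cderiv_const c)) as H2. simpl in H2.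
  replace (Cmul (RtoC (e' * ln x * pw (e 1) x)) c) with
    (Cadd (Cmul (RtoC (e' * ln x * pw (e 1) x)) c) (Cmul (RtoC (pw (e 1) x)) Czero)) by ring.
  exact H2.
Qed.

Lemma Opow_zero X : posdef l X -> Oeq l (Opow l X 0) Odelta.
Proof.
  intros HX. apply Ofun_one; [exact Hl|exact (proj1 HX)|]. intros k Hk.
  pose proof (sys_posdef l X _ _ (eig_system l X Hl (proj1 HX)) k HX Hk) as Hpos.
  unfold pw. destruct (Rlt_dec 0 _); [apply Rpower_O; auto|lra].
Qed.
Lemma Opow_one X : posdef l X -> Oeq l (Opow l X 1) X.
Proof.
  intros HX. apply Ofun_id; [exact Hl|exact (proj1 HX)|]. intros k Hk.
  pose proof (sys_posdef l X _ _ (eig_system l X Hl (proj1 HX)) k HX Hk) as Hpos.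
  unfold pw. destruct (Rlt_dec 0 _); [apply Rpower_1; auto|lra].
Qed.

Lemma tr_Ofun X f : hermitian l X -> Cre (Otr l (Ofun l f X)) =
  Rsum (seq 0 (length l)) (fun k => f (eigval l X k)).
Proof.
  intros HX. pose proof (eig_system l X Hl HX) as HS.
  rewrite (sys_trace_val l (Ofun l f X) (eigvec l X) (fun k => f (eigval l X k)) Hl).
  - reflexivity.
  - split; [apply (sys_orth _ _ _ _ HS)|]. intros i j _ _; reflexivity.
Qed.
Lemma tr_mul_Ofun_self X f : hermitian l X -> Cre (Otr l (Omul l X (Ofun l f X))) =
  Rsum (seq 0 (length l)) (fun k => f (eigval l X k) * eigval l X k).
Proof.
  intros HX. pose proof (eig_system l X Hl HX) as HS.
  rewrite Otr_mul_Ofun, Cre_Csum. apply Rsum_ext; intros k Hk. apply in_seq in Hk.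
  rewrite (sys_eigval l X _ _ HS) by lia. simpl; ring.
Qed.
End Tangent.

Section TangentPartialTrace.
Context {I K E : Type} {L : list I} {lk : list K} {le : list E}
  {phi : E -> K -> I} {pe : I -> E} {pk : I -> K}
  {marg : Op I -> Op K} {lift : Op K -> Op I}
  (PT : partial_trace L lk le phi pe pk marg lift).

Lemma tangent_lift F F1 F' : tangent lk F F1 F' ->
  tangent L (fun a => lift (F a)) (lift F1) (lift F').
Proof.
  intros H i j Hi Hj. apply (pt_in_L PT) in Hi; apply (pt_in_L PT) in Hj.
  rewrite !(lift_at PT).
  replace (fun a => lift (F a) i j) with (fun a =>
    if excluded_middle_informative (pe i = pe j) then F a (pk i) (pk j) else Czero)
    by (apply functional_extensionality; intros a; symmetry; apply (lift_at PT)).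
  destruct excluded_middle_informative.
  - apply H; tauto.
  - split; [reflexivity|apply Cderiv_const].
Qed.
Lemma tangent_marg F F1 F' : tangent L F F1 F' ->
  tangent lk (fun a => marg (F a)) (marg F1) (marg F').
Proof.
  intros H k k' Hk Hk'.
  assert (Hin : forall e k, In e le -> In k lk -> In (phi e k) L)
    by (intros; apply (pt_in _ _ _ _ _ _ _ _ PT); auto).
  rewrite !(pt_marg _ _ _ _ _ _ _ _ PT).
  replace (fun a => marg (F a) k k') with (fun a => Csum le (fun e => F a (phi e k) (phi e k')))
    by (apply functional_extensionality; intros a; symmetry; apply (pt_marg _ _ _ _ _ _ _ _ PT)).
  split.
  - apply Csum_ext; intros e He. apply H; auto.
  - apply (Cderiv_sum le (fun a e => F a (phi e k) (phi e k'))). intros e He. apply H; auto.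
Qed.
End TangentPartialTrace.

(** * Scalar inequalities and uniform Lipschitz bounds *)

Lemma Rabs_le_inv x b : Rabs x <= b -> - b <= x <= b.
Proof.
  intros H. pose proof (Rle_abs x). pose proof (Rle_abs (- x)) as H'.
  rewrite Rabs_Ropp in H'. lra.
Qed.

Lemma exp_bounds y : Rabs y <= / 2 -> 1 + y <= exp y <= 1 + y + 2 * y².
Proof.
  intros Hy. assert (Hy' : - / 2 <= y <= / 2) by (apply Rabs_le_inv; exact Hy).
  split; [apply exp_ineq1_le|].
  pose proof (exp_ineq1_le (- y)) as H. pose proof (exp_pos y) as Hp.
  assert (E : exp y * exp (- y) = 1) by (rewrite <- exp_plus, Rplus_opp_r; apply exp_0).
  assert (H1 : exp y * (1 - y) <= 1) by nra.
  (* The upper bound compares with [1 / (1 - y)]: here [(1 + y + 2 y^2) (1 - y) = 1 + y^2 (1 - 2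
     y)], which is at least [1] for [y <= 1/2]. *)
  unfold Rsqr. apply Rmult_le_reg_r with (1 - y); [lra|]. nra.
Qed.

(* Tangent line at [x = 1] of the concave function [x ^ e / e] ([e < 1]). *)
Lemma power_tangent x e : 0 < x -> e <> 0 -> e < 1 -> (Rpower x e - 1) / e <= x - 1.
Proof.
  intros Hx He0 He1. rewrite <- (exp_ln x Hx) at 2. unfold Rpower.
  set (y := ln x). destruct (Rlt_dec 0 e) as [He|He].
  - apply Rmult_le_reg_r with e; [exact He|]. replace ((exp (e * y) - 1) / e * e) with (exp (e * y) - 1) by (field; lra).
    pose proof (exp_pos (e * y)) as Hp.
    (* [H1] and [H2] are the tangent line of [exp] at [e * y], evaluated at [y] and at [0]. In the
       combination with weights [e] and [1 - e] the linear terms cancel. *)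
    assert (H1 : exp (e * y) * (1 + (y - e * y)) <= exp y).
    { replace y with (e * y + (y - e * y)) at 4 by ring. rewrite exp_plus.
      apply Rmult_le_compat_l; [lra|apply exp_ineq1_le]. }
    assert (H2 : exp (e * y) * (1 + - (e * y)) <= 1).
    { rewrite <- exp_0 at 2. rewrite <- (Rplus_opp_r (e * y)), exp_plus.
      apply Rmult_le_compat_l; [lra|apply exp_ineq1_le]. }
    nra.
  - assert (He' : 0 < - e) by lra. apply Rmult_le_reg_r with (- e); [exact He'|].
    replace ((exp (e * y) - 1) / e * - e) with (1 - exp (e * y)) by (field; lra).
    pose proof (exp_ineq1_le (e * y)). pose proof (exp_ineq1_le y). nra.
Qed.

(** The constants depend only on the lower bound [c] for [r] and the Lipschitz constant [K] of [t].
    There is no lower bound on [s] beyond positivity, so the estimate is uniform over all admissible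
    [sigma]. *)
Lemma perturbed_power_bound c K : 0 < c <= 1 -> 0 <= K ->
  exists M d, 0 <= M /\ 0 < d /\ d <= / 2 /\
    forall e r t s, e <> 0 -> Rabs e < d -> c <= r <= 1 -> 0 < s <= 1 -> Rabs (t - r) <= K * Rabs e ->
      0 < t /\ t * Rpower s e / e <= t / e + r * ln r + (s - r) + M * Rabs e.
Proof.
  intros Hc HK. set (B := - ln c).
  assert (HB : 0 <= B).
  { unfold B. destruct (Rle_lt_or_eq_dec _ _ (proj2 Hc)) as [H| ->].
    - pose proof (ln_increasing c 1 (proj1 Hc) H) as H'. rewrite ln_1 in H'. lra.
    - rewrite ln_1; lra. }
  (* [B] bounds the absolute value of [ln r]. In [M], the part [4 B^2] is the exponential remainder,
     [K B] the cost of replacing [t] by [r] in front of [ln r], and the quotient by [c] the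
     deviation of the slope from [1]. The thresholds ensure [e < 1], [|e| B <= 1/2] for
     [exp_bounds], and [K |e| <= c / 2], hence [t > 0]. *)
  exists (4 * B² + K * B + (2 * K + 2 * B) / c),
    (Rmin (/ 2) (Rmin (/ (2 * (B + 1))) (c / (2 * (K + 1))))).
  assert (Hd1 : 0 < / (2 * (B + 1))) by (apply Rinv_0_lt_compat; lra).
  assert (Hd2 : 0 < c / (2 * (K + 1))) by (apply Rdiv_lt_0_compat; lra).
  assert (HM : 0 <= (2 * K + 2 * B) / c) by (apply Rmult_le_pos; [lra|left; apply Rinv_0_lt_compat; lra]).
  assert (HB2 : 0 <= B²) by apply Rle_0_sqr.
  split; [nra|]. split; [repeat apply Rmin_pos; lra|]. split; [apply Rmin_l|].
  intros e r t s He0 He Hr Hs Ht.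
  assert (He1 : Rabs e < / 2) by (eapply Rlt_le_trans; [exact He|apply Rmin_l]).
  assert (He2 : Rabs e < / (2 * (B + 1)))
    by (eapply Rlt_le_trans; [exact He|]; eapply Rle_trans; [apply Rmin_r|apply Rmin_l]).
  assert (He3 : Rabs e < c / (2 * (K + 1)))
    by (eapply Rlt_le_trans; [exact He|]; eapply Rle_trans; [apply Rmin_r|apply Rmin_r]).
  clear He. pose proof (Rabs_pos_lt e He0) as Hea. set (ae := Rabs e) in *.
  assert (HeB : ae * B <= / 2).
  { assert (ae * (2 * (B + 1)) <= 1); [|nra].
    apply Rle_trans with (/ (2 * (B + 1)) * (2 * (B + 1))); [apply Rmult_le_compat_r; lra|].
    rewrite Rinv_l; lra. }
  assert (HeK : K * ae <= c / 2).
  { assert (ae * (2 * (K + 1)) <= c); [|nra].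
    apply Rle_trans with (c / (2 * (K + 1)) * (2 * (K + 1))); [apply Rmult_le_compat_r; lra|].
    right; field; lra. }
  assert (Htr : - (K * ae) <= t - r <= K * ae) by (apply Rabs_le_inv; exact Ht).
  assert (Hlr : - B <= ln r <= 0).
  { unfold B. split.
    - destruct (Rle_lt_or_eq_dec _ _ (proj1 Hr)) as [H| <-]; [|lra].
      pose proof (ln_increasing c r (proj1 Hc) H). lra.
    - destruct (Rle_lt_or_eq_dec _ _ (proj2 Hr)) as [H| ->]; [|rewrite ln_1; lra].
      pose proof (ln_increasing r 1 ltac:(lra) H) as H'. rewrite ln_1 in H'; lra. }
  assert (Ht0 : 0 < t <= 2) by lra. split; [lra|].
  set (y := e * ln r).
  assert (Hy : Rabs y <= ae * B).
  { unfold y. rewrite Rabs_mult. apply Rmult_le_compat_l; [unfold ae; apply Rabs_pos|].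
    apply Rabs_le; lra. }
  assert (HyE := exp_bounds y ltac:(lra)).
  assert (Hy2 : y² <= ae * (ae * B²)).
  { replace (ae * (ae * B²)) with ((ae * B)²) by (unfold Rsqr; ring).
    rewrite (Rsqr_abs y). apply Rsqr_incr_1; auto; [apply Rabs_pos|nra]. }
  assert (Hyv : - (ae * B) <= y <= ae * B) by (apply Rabs_le_inv; exact Hy).
  set (E := exp y) in *.
  assert (HyB : 2 * y² <= ae * B) by (unfold Rsqr in *; nra).
  assert (HE1 : - (2 * (ae * B)) <= E - 1 <= 2 * (ae * B)) by (unfold Rsqr in *; lra).
  assert (HE2 : 0 < E <= 2) by (split; [apply exp_pos|lra]).
  assert (HrE : Rpower r e = E) by reflexivity.
  (* Factor [s^e = r^e (s / r)^e] and apply the tangent line at [1] to the ratio [s / r]; this is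
     the only place where [s] enters a power. *)
  assert (Hstep : t * Rpower s e / e <= t * E / e + t * E / r * (s - r)).
  { assert (Hsr : 0 < s / r) by (apply Rdiv_lt_0_compat; lra).
    pose proof (power_tangent (s / r) e Hsr He0 ltac:(pose proof (Rle_abs e); fold ae in H; lra)) as H.
    assert (Es : Rpower s e = E * Rpower (s / r) e).
    { rewrite <- HrE, Rpower_mult_distr by lra. f_equal. field; lra. }
    rewrite Es.
    replace (t * (E * Rpower (s / r) e) / e) with (t * E * ((Rpower (s / r) e - 1) / e) + t * E / e)
      by (field; exact He0).
    replace (t * E / r * (s - r)) with (t * E * (s / r - 1)) by (field; lra).
    assert (0 <= t * E) by nra. nra. }
  assert (HA : t * E / e <= t / e + r * ln r + (4 * B² + K * B) * ae).
  { replace (t * E / e) with (t / e + t * ln r + t * ((E - 1 - y) / e)) by (unfold y; field; exact He0).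
    assert (H1 : (E - 1 - y) / e <= 2 * (ae * B²)).
    { eapply Rle_trans; [apply Rle_abs|]. unfold Rdiv. rewrite Rabs_mult, Rabs_inv. fold ae.
      rewrite Rabs_pos_eq by lra.
      apply Rmult_le_reg_r with ae; [exact Hea|]. rewrite Rmult_assoc, Rinv_l by lra. nra. }
    assert (0 <= ae * B²) by nra.
    assert (t * ((E - 1 - y) / e) <= 4 * (ae * B²)) by nra.
    assert ((t - r) * ln r <= K * ae * B) by nra.
    nra. }
  (* The slope [t r^e / r] is [1 + O(e)], and [s - r] is at most [1] in absolute value. *)
  assert (HB' : t * E / r * (s - r) <= (s - r) + (2 * K + 2 * B) / c * ae).
  { assert (H1 : Rabs (t * E / r - 1) <= (2 * K + 2 * B) / c * ae).
    { replace (t * E / r - 1) with ((t * E - r) / r) by (field; lra).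
      unfold Rdiv at 1. rewrite Rabs_mult, Rabs_inv, (Rabs_pos_eq r) by lra.
      assert (H2 : Rabs (t * E - r) <= (2 * K + 2 * B) * ae).
      { apply Rabs_le. replace (t * E - r) with ((t - r) * E + r * (E - 1)) by ring.
        assert (0 <= K * ae) by nra. assert (0 <= ae * B) by nra.
        assert (- (2 * (K * ae)) <= (t - r) * E <= 2 * (K * ae)) by nra.
        assert (- (2 * (ae * B)) <= r * (E - 1) <= 2 * (ae * B)) by nra.
        lra. }
      assert (H3 : / r <= / c) by (apply Rinv_le_contravar; lra).
      assert (H4 : 0 < / r) by (apply Rinv_0_lt_compat; lra).
      replace ((2 * K + 2 * B) / c * ae) with ((2 * K + 2 * B) * ae * / c) by (field; lra).
      apply Rmult_le_compat; try lra. apply Rabs_pos. }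
    assert (H2 : Rabs ((t * E / r - 1) * (s - r)) <= (2 * K + 2 * B) / c * ae).
    { rewrite Rabs_mult. rewrite <- (Rmult_1_r ((2 * K + 2 * B) / c * ae)).
      apply Rmult_le_compat; try apply Rabs_pos; [exact H1|]. apply Rabs_le; lra. }
    pose proof (Rle_abs ((t * E / r - 1) * (s - r))). lra. }
  fold ae. lra.
Qed.

(** Over a finite list, take the largest [K] and the smallest [d]; monotonicity of [P] makes them
    work for every member. *)
Lemma uniform_bound {J : Type} (l : list J) (P : J -> R -> R -> Prop) :
  (forall j K K' d d', K <= K' -> d' <= d -> P j K d -> P j K' d') ->
  (forall j, In j l -> exists K d, 0 <= K /\ 0 < d /\ P j K d) ->
  exists K d, 0 <= K /\ 0 < d /\ forall j, In j l -> P j K d.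
Proof.
  intros Hmono. induction l as [|x l IH]; intros H.
  - exists 0, 1. repeat split; try lra. intros j [].
  - destruct IH as [K [d [HK [Hd HP]]]]; [intros; apply H; simpl; auto|].
    destruct (H x (or_introl eq_refl)) as [K' [d' [HK' [Hd' HP']]]].
    exists (Rmax K K'), (Rmin d d'). split; [eapply Rle_trans; [exact HK|apply Rmax_l]|].
    split; [apply Rmin_pos; auto|].
    intros j [<-|Hj].
    + apply (Hmono x K' _ d'); [apply Rmax_r|apply Rmin_r|exact HP'].
    + apply (Hmono j K _ d); [apply Rmax_l|apply Rmin_l|auto].
Qed.

Lemma derivable_lipschitz f d : derivable_pt_lim f 1 d ->
  exists K dl, 0 <= K /\ 0 < dl /\ forall a, Rabs (a - 1) < dl -> Rabs (f a - f 1) <= K * Rabs (a - 1).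
Proof.
  intros H. destruct (H 1 Rlt_0_1) as [dl Hd].
  exists (Rabs d + 1), dl. split; [pose proof (Rabs_pos d); lra|]. split; [apply cond_pos|].
  intros a Ha. destruct (Req_dec a 1) as [->|Hne].
  - rewrite 2 Rminus_diag, Rabs_R0. lra.
  - specialize (Hd (a - 1) ltac:(lra) Ha). replace (1 + (a - 1)) with a in Hd by ring.
    replace (f a - f 1) with ((f a - f 1) / (a - 1) * (a - 1)) by (field; lra).
    rewrite Rabs_mult. apply Rmult_le_compat_r; [apply Rabs_pos|].
    pose proof (Rabs_triang ((f a - f 1) / (a - 1) - d) d).
    replace ((f a - f 1) / (a - 1) - d + d) with ((f a - f 1) / (a - 1)) in H0 by ring. lra.
Qed.

Lemma tangent_lipschitz {I} (l : list I) F F1 F' : tangent l F F1 F' ->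
  exists K dl, 0 <= K /\ 0 < dl /\ forall i, In i l -> forall j, In j l ->
    forall a, Rabs (a - 1) < dl ->
      Rabs (Cre (F a i j) - Cre (F1 i j)) <= K * Rabs (a - 1) /\
      Rabs (Cim (F a i j) - Cim (F1 i j)) <= K * Rabs (a - 1).
Proof.
  intros H.
  set (P := fun i j K dl => forall a, Rabs (a - 1) < dl ->
      Rabs (Cre (F a i j) - Cre (F1 i j)) <= K * Rabs (a - 1) /\
      Rabs (Cim (F a i j) - Cim (F1 i j)) <= K * Rabs (a - 1)).
  assert (Hmono : forall i j K K' d d', K <= K' -> d' <= d -> P i j K d -> P i j K' d').
  { intros i j K K' d d' HK Hd HP a Ha. destruct (HP a ltac:(lra)) as [H1 H2].
    pose proof (Rabs_pos (a - 1)). split; nra. }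
  apply (uniform_bound l (fun i K dl => forall j, In j l -> P i j K dl)).
  - intros i K K' d d' HK Hd HP j Hj. apply (Hmono i j K _ d); auto.
  - intros i Hi. apply (uniform_bound l (fun j => P i j)); [intros j; apply Hmono|].
    intros j Hj. destruct (H i j Hi Hj) as [E [D1 D2]].
    destruct (derivable_lipschitz _ _ D1) as [K1 [d1 [HK1 [Hd1 H1]]]].
    destruct (derivable_lipschitz _ _ D2) as [K2 [d2 [HK2 [Hd2 H2]]]].
    exists (Rmax K1 K2), (Rmin d1 d2). split; [eapply Rle_trans; [exact HK1|apply Rmax_l]|].
    split; [apply Rmin_pos; auto|]. intros a Ha. rewrite <- E.
    pose proof (Rmin_l d1 d2). pose proof (Rmin_r d1 d2).
    pose proof (Rmax_l K1 K2). pose proof (Rmax_r K1 K2). pose proof (Rabs_pos (a - 1)).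
    split; [eapply Rle_trans; [apply H1; lra|]|eapply Rle_trans; [apply H2; lra|]];
      apply Rmult_le_compat_r; auto.
Qed.

(** A crude entrywise estimate suffices because its constant does not depend on [v]; applied to
    eigenvectors of [sigma], it is uniform in [sigma]. Real and imaginary parts of an entry
    difference each have a coefficient of modulus at most [2], whence [4 K]. *)
Lemma quad_lipschitz {I} (l : list I) X Y v K :
  (forall i, In i l -> Cnorm2 (v i) <= 1) ->
  (forall i, In i l -> forall j, In j l ->
     Rabs (Cre (X i j) - Cre (Y i j)) <= K /\ Rabs (Cim (X i j) - Cim (Y i j)) <= K) ->
  Rabs (quad l X v - quad l Y v) <= INR (length l) * (INR (length l) * (4 * K)).
Proof.
  intros Hv H. unfold quad. rewrite 2 inner_app, 2 Cre_Csum, <- Rsum_sub.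
  eapply Rle_trans; [apply Rabs_Rsum|]. rewrite <- Rsum_const. apply Rsum_le; intros i Hi.
  rewrite 2 Cre_Csum, <- Rsum_sub.
  eapply Rle_trans; [apply Rabs_Rsum|]. rewrite <- Rsum_const. apply Rsum_le; intros j Hj.
  destruct (H i Hi j Hj) as [H1 H2]. pose proof (Hv i Hi) as Vi. pose proof (Hv j Hj) as Vj.
  unfold Cnorm2 in Vi, Vj. simpl.
  set (x := Cre (v i)) in *. set (x' := Cim (v i)) in *.
  set (z := Cre (v j)) in *. set (z' := Cim (v j)) in *.
  replace (_ - _) with ((Cre (X i j) - Cre (Y i j)) * (x * z + x' * z')
    + (Cim (X i j) - Cim (Y i j)) * (x' * z - x * z')) by ring.
  eapply Rle_trans; [apply Rabs_triang|]. rewrite 2 Rabs_mult.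
  assert (B1 : Rabs (x * z + x' * z') <= 2) by (apply Rabs_le; pose proof (Rle_0_sqr (x - z)); pose proof (Rle_0_sqr (x' - z'));
      pose proof (Rle_0_sqr (x + z)); pose proof (Rle_0_sqr (x' + z')); unfold Rsqr in *; lra).
  assert (B2 : Rabs (x' * z - x * z') <= 2) by (apply Rabs_le; pose proof (Rle_0_sqr (x' - z)); pose proof (Rle_0_sqr (x - z'));
      pose proof (Rle_0_sqr (x' + z)); pose proof (Rle_0_sqr (x + z')); unfold Rsqr in *; lra).
  pose proof (Rabs_pos (x * z + x' * z')). pose proof (Rabs_pos (x' * z - x * z')).
  pose proof (Rabs_pos (Cre (X i j) - Cre (Y i j))). pose proof (Rabs_pos (Cim (X i j) - Cim (Y i j))).
  apply Rle_trans with (K * 2 + K * 2); [|lra].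
  apply Rplus_le_compat; apply Rmult_le_compat; assumption.
Qed.

(** * The limit *)

Lemma ln_le_sub1 x : 0 < x -> ln x <= x - 1.
Proof. intros Hx. pose proof (exp_ineq1_le (ln x)) as H. rewrite exp_ln in H by exact Hx. lra. Qed.

(** Passing to the logarithm is where the sign of [e] matters. For [e > 0] the hypothesis bounds [X]
    above and [ln X <= X - 1] loses nothing. For [e < 0] it bounds [X] below by [1 + y] with
    [y = |e| B], and [ln X >= 1 - 1 / X >= y - 2 y^2] produces the quadratic loss. *)
Lemma renyi_scalar_lower e X B : e <> 0 -> 0 < X -> (X - 1) / e <= - B ->
  Rabs e * Rabs B <= / 2 -> B - 2 * Rabs e * B² <= / (- e) * ln X.
Proof.
  intros He HX H HB. destruct (Rlt_dec 0 e) as [Hp|Hn].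
  - assert (B <= / (- e) * ln X).
    { apply Rmult_le_reg_r with e; [exact Hp|].
      replace (/ (- e) * ln X * e) with (- ln X) by (field; lra).
      pose proof (ln_le_sub1 X HX).
      assert (X - 1 <= - B * e); [|lra].
      replace (X - 1) with ((X - 1) / e * e) by (field; lra). apply Rmult_le_compat_r; lra. }
    pose proof (Rle_0_sqr B). pose proof (Rabs_pos e). nra.
  - assert (Hn' : e < 0) by lra. rewrite (Rabs_left e) in * by exact Hn'.
    set (q := - e) in *. assert (Hq : 0 < q) by (unfold q; lra).
    set (y := q * B).
    assert (Hy : - / 2 <= y <= / 2).
    { apply Rabs_le_inv. unfold y. rewrite Rabs_mult, (Rabs_pos_eq q) by lra. exact HB. }
    assert (HXy : 1 + y <= X).
    { assert (H1 : - ((X - 1) / e) * q = X - 1) by (unfold q; field; exact He).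
      assert (y <= - ((X - 1) / e) * q); [unfold y; rewrite Rmult_comm; apply Rmult_le_compat_r; lra|lra]. }
    assert (Hinv : 0 < / X) by (apply Rinv_0_lt_compat; exact HX).
    pose proof (ln_le_sub1 (/ X) Hinv) as Hl. rewrite ln_Rinv in Hl by exact HX.
    assert (Hi : / X <= / (1 + y)) by (apply Rinv_le_contravar; lra).
    assert (Hi2 : / (1 + y) <= 1 - y + 2 * y²).
    { apply Rmult_le_reg_r with (1 + y); [lra|]. rewrite Rinv_l by lra.
      unfold Rsqr. assert (0 <= y * y) by apply Rle_0_sqr. nra. }
    apply Rmult_le_reg_l with q; [exact Hq|].
    replace (q * (/ q * ln X)) with (ln X) by (field; lra).
    replace (q * (B - 2 * q * B²)) with (y - 2 * y²) by (unfold y, Rsqr; ring). lra.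
Qed.

Lemma positive_lower_bound {J : Type} (l : list J) (f : J -> R) :
  (forall j, In j l -> 0 < f j) -> exists c, 0 < c <= 1 /\ forall j, In j l -> c <= f j.
Proof.
  induction l as [|x l IH]; intros H.
  - exists 1. split; [lra|]. intros j [].
  - destruct IH as [c [Hc HP]]; [intros; apply H; simpl; auto|].
    pose proof (H x (or_introl eq_refl)) as Hx.
    exists (Rmin c (f x)). split; [split; [apply Rmin_pos; lra|eapply Rle_trans; [apply Rmin_l|lra]]|].
    intros j [<-|Hj]; [apply Rmin_r|eapply Rle_trans; [apply Rmin_l|auto]].
Qed.

(** A nonempty set bounded below has an infimum, by completeness applied to its negation; so the
    default value [0] of [Rinf] is excluded. *)
Lemma Rinf_between (S : R -> Prop) m y : (forall z, S z -> m <= z) -> S y -> m <= Rinf S <= y.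
Proof.
  intros Hm Hy.
  assert (HE : exists g, is_glb S g).
  { destruct (completeness (fun z => S (- z))) as [g [Hg1 Hg2]].
    - exists (- m). intros z Hz. specialize (Hm _ Hz). lra.
    - exists (- y). rewrite Ropp_involutive. exact Hy.
    - exists (- g). split.
      + intros z Hz. assert (- z <= g) by (apply Hg1; rewrite Ropp_involutive; exact Hz). lra.
      + intros m' Hm'. specialize (Hg2 (- m')).
        assert (is_upper_bound (fun z => S (- z)) (- m')) by (intros z Hz; specialize (Hm' _ Hz); lra).
        specialize (Hg2 H). lra. }
  unfold Rinf. destruct excluded_middle_informative as [H|H]; [|contradiction].
  destruct (proj2_sig (constructive_indefinite_description _ H)) as [H1 H2]. split; auto.
Qed.

Lemma posdef_psd {I} (l : list I) X : posdef l X -> psd l X.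
Proof.
  intros [Hh Hp]. split; [exact Hh|]. intros v.
  destruct (excluded_middle_informative (exists i, In i l /\ v i <> Czero)) as [H|H];
    [left; apply Hp; exact H|right].
  unfold inner. rewrite (Csum_ext _ _ (fun _ => Czero)), Csum_zero; [reflexivity|].
  intros i Hi. destruct (excluded_middle_informative (v i = Czero)) as [->|Hn];
    [rewrite Cconj_zero; ring|exfalso; apply H; exists i; auto].
Qed.

Lemma sys_unit {I} (l : list I) X V lam k : spectral_system l X V lam -> (k < length l)%nat ->
  inner l (V k) (V k) = Cone.
Proof.
  intros HS Hk. rewrite (sys_orth _ _ _ _ HS) by exact Hk. destruct Nat.eq_dec; [reflexivity|congruence].
Qed.
Lemma unit_vector_entry {I} (l : list I) v i : inner l v v = Cone -> In i l -> Cnorm2 (v i) <= 1.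
Proof.
  intros Hv Hi.
  assert (E : Rsum l (fun i => Cnorm2 (v i)) = 1).
  { change 1 with (Cre Cone). rewrite <- Hv. unfold inner. rewrite Cre_Csum.
    apply Rsum_ext; intros j _. rewrite Cmul_conj. reflexivity. }
  rewrite <- E. apply (Rsum_ge_term l (fun i => Cnorm2 (v i))); [intros; apply Cnorm2_pos|exact Hi].
Qed.
Lemma Cnorm2_inner_sym {I} (l : list I) v w : Cnorm2 (inner l v w) = Cnorm2 (inner l w v).
Proof. rewrite <- (inner_conj l w v). unfold Cnorm2; simpl; ring. Qed.
Lemma overlap_sum {I} (l : list I) X V lam v : NoDup l -> spectral_system l X V lam ->
  inner l v v = Cone -> Rsum (seq 0 (length l)) (fun k => Cnorm2 (inner l (V k) v)) = 1.
Proof.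
  intros Hl HS Hv. rewrite (sys_parseval l X V lam Hl HS) in Hv. injection Hv; auto.
Qed.

(** On a unit vector the quadratic form is an average of the eigenvalues with weights
    [Cnorm2 (inner l (V k) v)]. This keeps the [r_j] away from [0] in every basis. *)
Lemma quad_ge {I} (l : list I) X V lam c v : NoDup l -> spectral_system l X V lam ->
  (forall k, (k < length l)%nat -> c <= lam k) -> inner l v v = Cone -> c <= quad l X v.
Proof.
  intros Hl HS Hc Hv. rewrite (sys_quad l X V lam HS).
  rewrite <- (Rmult_1_r c), <- (overlap_sum l X V lam v Hl HS Hv), <- Rsum_mul_l.
  apply Rsum_le; intros k Hk. apply in_seq in Hk.
  apply Rmult_le_compat_r; [apply Cnorm2_pos|apply Hc; lia].
Qed.

(* Peierls' inequality for [x ln x]: Jensen along each row of the doubly stochastic overlap matrix. *)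
Lemma peierls_xlnx {I} (l : list I) X V lam Y W mu : NoDup l -> spectral_system l X V lam ->
  spectral_system l Y W mu -> (forall k, (k < length l)%nat -> 0 < lam k) ->
  (forall j, (j < length l)%nat -> 0 < quad l X (W j)) ->
  Rsum (seq 0 (length l)) (fun j => quad l X (W j) * ln (quad l X (W j))) <=
  Rsum (seq 0 (length l)) (fun k => lam k * ln (lam k)).
Proof.
  intros Hl HX HY Hlam Hr.
  apply Rle_trans with (Rsum (seq 0 (length l)) (fun j => Rsum (seq 0 (length l)) (fun k =>
    lam k * ln (lam k) * Cnorm2 (inner l (V k) (W j))))).
  - apply Rsum_le; intros j Hj. apply in_seq in Hj. set (r := quad l X (W j)).
    assert (Hrj : 0 < r) by (apply Hr; lia).
    pose proof (overlap_sum l X V lam (W j) Hl HX (sys_unit l Y W mu j HY ltac:(lia))) as Hov.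
    assert (Er : r = Rsum (seq 0 (length l)) (fun k => lam k * Cnorm2 (inner l (V k) (W j))))
      by apply (sys_quad l X V lam HX).
    (* Jensen through the tangent of [x ln x] at [r]: since the weights sum to [1] and the weighted
       mean of [lam k] is [r], this sum equals [r ln r], and its terms are compared one at a
       time. *)
    apply Rle_trans with (Rsum (seq 0 (length l)) (fun k =>
      ln r * (lam k * Cnorm2 (inner l (V k) (W j)))
      + (lam k * Cnorm2 (inner l (V k) (W j)) - r * Cnorm2 (inner l (V k) (W j))))).
    + rewrite Rsum_add, Rsum_sub, 2 Rsum_mul_l, Hov, <- Er. lra.
    + apply Rsum_le; intros k Hk. apply in_seq in Hk. set (p := Cnorm2 _).
      assert (Hp : 0 <= p) by apply Cnorm2_pos.
      assert (Hx : 0 < lam k) by (apply Hlam; lia).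
      pose proof (ln_le_sub1 (r * / lam k) ltac:(apply Rmult_lt_0_compat; [lra|apply Rinv_0_lt_compat; lra])) as H.
      rewrite ln_mult, ln_Rinv in H by (try apply Rinv_0_lt_compat; lra).
      assert (H2 : lam k * (ln r + - ln (lam k)) <= r - lam k).
      { replace (r - lam k) with (lam k * (r * / lam k - 1)) by (field; lra).
        apply Rmult_le_compat_l; lra. }
      nra.
  (* Summing over [j] first uses the other half of double stochasticity: expanding [V k] in the
     basis [W] gives total weight [1]. *)
  - rewrite Rsum_exchange. right. apply Rsum_ext; intros k Hk. apply in_seq in Hk.
    rewrite Rsum_mul_l.
    rewrite (Rsum_ext _ _ (fun j => Cnorm2 (inner l (W j) (V k)))) by (intros; apply Cnorm2_inner_sym).
    rewrite (overlap_sum l Y W mu (V k) Hl HY (sys_unit l X V lam k HX ltac:(lia))). ring.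
Qed.

Lemma tangent_Opow_zero {I} (l : list I) X e e' : NoDup l -> posdef l X -> e 1 = 0 ->
  derivable_pt_lim e 1 e' ->
  tangent l (fun a => Opow l X (e a)) Odelta (Ofun l (fun x => e' * ln x * pw 0 x) X).
Proof.
  intros Hl HX He1 He. pose proof (tangent_Opow l Hl X e e' HX He) as H. rewrite He1 in H.
  eapply tangent_ext; [exact H|apply Opow_zero; assumption|intros ? ? _ _; reflexivity].
Qed.

Definition eta_sum {I} (l : list I) X : R := Rsum (seq 0 (length l)) (fun k => eta (eigval l X k)).

(** The operator inside [lift] is the derivative of a power of the marginal whose exponent vanishes
    at [a = 1] with slope [c]. Pairing it with [M] gives [c] times minus the entropy of the
    marginal. *)
Lemma tr_mul_lift_log {I K E} {L : list I} {lk : list K} {le : list E} {phi pe pk marg lift}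
  (PT : partial_trace L lk le phi pe pk marg lift) M c : NoDup lk -> posdef lk (marg M) ->
  Cre (Otr L (Omul L M (lift (Ofun lk (fun x => c * ln x * pw 0 x) (marg M))))) = c * eta_sum lk (marg M).
Proof.
  intros Hl HM. rewrite (tr_mul_lift PT), (tr_mul_Ofun_self lk Hl _ _ (proj1 HM)).
  unfold eta_sum. rewrite <- Rsum_mul_l. apply Rsum_ext; intros k Hk. apply in_seq in Hk.
  pose proof (sys_posdef lk _ _ _ (eig_system lk _ Hl (proj1 HM)) k HM ltac:(lia)) as Hpos.
  unfold eta, pw. destruct (Rlt_dec 0 _); [|lra]. rewrite Rpower_O by lra. ring.
Qed.

Lemma derivable_affine c d : derivable_pt_lim (fun a => c * a + d) 1 c.
Proof.
  eapply derivable_pt_lim_eq.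
  - apply (derivable_pt_lim_plus (fun a => c * a) (fun _ => d)).
    + apply (derivable_pt_lim_mult (fun _ => c) (fun a => a));
        [apply derivable_pt_lim_const|apply derivable_pt_lim_id].
    + apply derivable_pt_lim_const.
  - simpl. ring.
Qed.

(** * The Renyi trace near [a = 1]: upper bound, lower bound, limit *)

Section RenyiLimit.
Variables (dA dB dC : nat) (rho : Op (nat * nat * nat)).
Hypotheses (Hpd : posdef (enABC dA dB dC) rho) (Htr : Otr (enABC dA dB dC) rho = Cone).

Let L := enABC dA dB dC.
Let lAC := enPair dA dC.
Let lBC := enPair dB dC.
Let lC := enA dC.
Let rAC := margAC dB rho.
Let rBC := margBC dA rho.
Let rC := margC dA dB rho.
Let PTAC := partial_trace_AC dA dB dC.
Let PTBC := partial_trace_BC dA dB dC.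
Let PTC := partial_trace_C dA dB dC.
Let HL : NoDup L := NoDup_enABC dA dB dC.
Let HlAC : NoDup lAC := NoDup_enPair dA dC.
Let HlBC : NoDup lBC := NoDup_enPair dB dC.
Let HlC : NoDup lC := seq_NoDup dC 0.

(** With an empty factor the trace of [rho] would be an empty sum, hence [0] instead of [1]. *)
Lemma dims_nonempty : seq 0 dA <> nil /\ seq 0 dB <> nil /\ enPair dA dB <> nil.
Proof.
  assert (HA : dA <> O) by (intros ->; unfold Otr in Htr; simpl in Htr; injection Htr; lra).
  assert (HB : dB <> O).
  { intros ->. unfold Otr in Htr. rewrite Csum_enABC in Htr. simpl in Htr.
    rewrite Csum_zero in Htr. injection Htr; lra. }
  destruct dA, dB; try congruence. simpl. repeat split; discriminate.
Qed.

Lemma posdef_AC : posdef lAC rAC.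
Proof. apply (marg_posdef PTAC); [apply dims_nonempty|exact Hpd]. Qed.
Lemma posdef_BC : posdef lBC rBC.
Proof. apply (marg_posdef PTBC); [apply dims_nonempty|exact Hpd]. Qed.
Lemma posdef_C : posdef lC rC.
Proof. apply (marg_posdef PTC); [apply dims_nonempty|exact Hpd]. Qed.

Let Rho (a : R) := Opow L rho a.
Let P (a : R) := liftAC (Opow lAC rAC ((1 - a) / 2)).
Let Q (a : R) := liftC (Opow lC rC ((a - 1) / 2)).
(** [T_a] before the partial trace: [T_a] is [margBC dA (M a)]. *)
Let M (a : R) := Omul L (Q a) (Omul L (P a) (Omul L (Rho a) (Omul L (P a) (Q a)))).
Let P' := liftAC (Ofun lAC (fun x => - / 2 * ln x * pw 0 x) rAC).
Let Q' := liftC (Ofun lC (fun x => / 2 * ln x * pw 0 x) rC).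
Let Rho' := Ofun L (fun x => 1 * ln x * pw 1 x) rho.

Lemma tangent_P : tangent L P Odelta P'.
Proof.
  eapply tangent_ext.
  - apply (tangent_lift PTAC). apply (tangent_Opow_zero lAC rAC (fun a => (1 - a) / 2) (- / 2) HlAC posdef_AC).
    + lra.
    + replace (fun a => (1 - a) / 2) with (fun a => - / 2 * a + / 2)
        by (apply functional_extensionality; intros; lra). apply derivable_affine.
  - apply (lift_delta PTAC). intros ? ? _ _; reflexivity.
  - intros ? ? _ _; reflexivity.
Qed.
Lemma tangent_Q : tangent L Q Odelta Q'.
Proof.
  eapply tangent_ext.
  - apply (tangent_lift PTC). apply (tangent_Opow_zero lC rC (fun a => (a - 1) / 2) (/ 2) HlC posdef_C).
    + lra.
    + replace (fun a => (a - 1) / 2) with (fun a => / 2 * a + - / 2)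
        by (apply functional_extensionality; intros; lra). apply derivable_affine.
  - apply (lift_delta PTC). intros ? ? _ _; reflexivity.
  - intros ? ? _ _; reflexivity.
Qed.
Lemma tangent_Rho : tangent L Rho rho Rho'.
Proof.
  eapply tangent_ext.
  - apply (tangent_Opow L HL rho (fun a => a) 1 Hpd (derivable_pt_lim_id 1)).
  - apply Opow_one; [exact HL|exact Hpd].
  - intros ? ? _ _; reflexivity.
Qed.

(** The derivative is left existential: it serves only to bound [T_a - rho_BC] by a multiple of
    [|a - 1|]. *)
Lemma tangent_M : exists M', tangent L M rho M'.
Proof.
  eexists. apply (tangent_mul_id_l L HL); [exact tangent_Q|].
  apply (tangent_mul_id_l L HL); [exact tangent_P|].
  apply (tangent_mul_id_r L HL); [exact tangent_Rho|].
  apply (tangent_mul_id L HL); [exact tangent_P|exact tangent_Q].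
Qed.

(** The last factor is a parameter because two choices are used: powers of [rho_BC] for the upper
    bound, and the constant identity, for which [G] is [Tr T_a], in the lower bound. *)
Let G (S : R -> Op (nat * nat * nat)) (a : R) : R := Cre (Otr L (Omul L (Rho a)
  (Omul L (P a) (Omul L (Q a) (Omul L (S a) (Omul L (Q a) (P a))))))).

Lemma tr_cyclic a S : Otr L (Omul L (Rho a) (Omul L (P a) (Omul L (Q a)
    (Omul L S (Omul L (Q a) (P a)))))) = Otr L (Omul L (M a) S).
Proof.
  unfold M. set (r := Rho a). set (p := P a). set (q := Q a).
  replace (Omul L r (Omul L p (Omul L q (Omul L S (Omul L q p)))))
    with (Omul L (Omul L r (Omul L p q)) (Omul L S (Omul L q p)))
    by (rewrite <- !Omul_assoc; reflexivity).
  rewrite Otr_mul_comm.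
  replace (Omul L (Omul L S (Omul L q p)) (Omul L r (Omul L p q)))
    with (Omul L S (Omul L q (Omul L p (Omul L r (Omul L p q)))))
    by (rewrite <- !Omul_assoc; reflexivity).
  apply Otr_mul_comm.
Qed.

(** [P] and [Q] each occur twice, so their slopes [-1/2] and [1/2] add up to coefficients [-1] and
    [1]; [rho^a] contributes [Tr (rho ln rho)]. *)
Lemma G_deriv S S' : tangent L S Odelta S' -> G S 1 = 1 /\
  derivable_pt_lim (G S) 1 (eta_sum L rho - eta_sum lAC rAC + eta_sum lC rC
    + Cre (Otr L (Omul L rho S'))).
Proof.
  intros HS.
  pose proof (tangent_mul_id_r L HL _ _ _ _ _ tangent_Rho
    (tangent_mul_id L HL _ _ _ _ tangent_P (tangent_mul_id L HL _ _ _ _ tangent_Q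
      (tangent_mul_id L HL _ _ _ _ HS (tangent_mul_id L HL _ _ _ _ tangent_Q tangent_P))))) as H.
  split.
  - unfold G. rewrite (Otr_ext L _ rho); [unfold L; rewrite Htr; reflexivity|].
    intros i j Hi Hj. apply (H i j Hi Hj).
  - eapply derivable_pt_lim_eq; [apply (tangent_tr L _ _ _ H)|].
    rewrite !Omul_add_r, !Otr_add. cbn [Cre Cadd].
    assert (EP : Cre (Otr L (Omul L rho P')) = - / 2 * eta_sum lAC rAC)
      by (apply (tr_mul_lift_log PTAC); [exact HlAC|exact posdef_AC]).
    assert (EQ : Cre (Otr L (Omul L rho Q')) = / 2 * eta_sum lC rC)
      by (apply (tr_mul_lift_log PTC); [exact HlC|exact posdef_C]).
    assert (ER : Cre (Otr L Rho') = eta_sum L rho).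
    { unfold Rho'. rewrite (tr_Ofun L HL _ _ (proj1 Hpd)). apply Rsum_ext; intros k Hk. apply in_seq in Hk.
      pose proof (sys_posdef L _ _ _ (eig_system L _ HL (proj1 Hpd)) k Hpd ltac:(lia)) as Hpos.
      unfold eta, pw. destruct (Rlt_dec 0 _); [|lra]. rewrite Rpower_1 by lra. ring. }
    rewrite EP, EQ, ER. lra.
Qed.

Lemma CMI_eta : CMI dA dB dC rho =
  eta_sum L rho - eta_sum lAC rAC + eta_sum lC rC - eta_sum lBC rBC.
Proof.
  unfold CMI. fold L lAC lBC lC rAC rBC rC.
  rewrite (vN_entropy_eig lAC rAC HlAC (proj1 posdef_AC)), (vN_entropy_eig lBC rBC HlBC (proj1 posdef_BC)),
    (vN_entropy_eig lC rC HlC (proj1 posdef_C)), (vN_entropy_eig L rho HL (proj1 Hpd)).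
  unfold eta_sum. lra.
Qed.

Lemma density_BC : density lBC rBC.
Proof.
  split; [apply posdef_psd; exact posdef_BC|].
  unfold rBC. rewrite (marg_tr PTBC). exact Htr.
Qed.

Lemma renyiTr_upper : forall eps, 0 < eps -> exists dl, 0 < dl /\
  forall a, a <> 1 -> Rabs (a - 1) < dl ->
    / (a - 1) * ln (Cre (renyiTr dA dB dC a rho rBC)) <= CMI dA dB dC rho + eps.
Proof.
  intros eps Heps.
  set (S := fun a => liftBC (Opow lBC rBC (1 - a))).
  assert (HS : tangent L S Odelta (liftBC (Ofun lBC (fun x => -1 * ln x * pw 0 x) rBC))).
  { eapply tangent_ext.
    - apply (tangent_lift PTBC). apply (tangent_Opow_zero lBC rBC (fun a => 1 - a) (-1) HlBC posdef_BC).
      + lra.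
      + replace (fun a => 1 - a) with (fun a => -1 * a + 1)
          by (apply functional_extensionality; intros; lra). apply derivable_affine.
    - apply (lift_delta PTBC). intros ? ? _ _; reflexivity.
    - intros ? ? _ _; reflexivity. }
  destruct (G_deriv S _ HS) as [H1 HD].
  assert (EB : Cre (Otr L (Omul L rho (liftBC (Ofun lBC (fun x => -1 * ln x * pw 0 x) rBC))))
    = -1 * eta_sum lBC rBC) by (apply (tr_mul_lift_log PTBC); [exact HlBC|exact posdef_BC]).
  rewrite EB in HD.
  (* As [ln (G S 1) = 0], the Renyi expression is exactly the difference quotient of [ln (G S a)] at
     [1]. *)
  assert (HL' : derivable_pt_lim (fun a => ln (G S a)) 1 (CMI dA dB dC rho)).
  { eapply derivable_pt_lim_eq.
    - apply (derivable_pt_lim_comp (G S) ln); [exact HD|]. apply derivable_pt_lim_ln. rewrite H1; lra.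
    - rewrite H1, CMI_eta. field. }
  destruct (HL' eps Heps) as [dl Hdl]. exists dl. split; [apply cond_pos|].
  intros a Ha Had. specialize (Hdl (a - 1) ltac:(lra) Had).
  replace (1 + (a - 1)) with a in Hdl by ring. rewrite H1, ln_1, Rminus_0_r in Hdl.
  pose proof (Rle_abs (ln (G S a) / (a - 1) - CMI dA dB dC rho)) as Habs.
  change (Cre (renyiTr dA dB dC a rho rBC)) with (G S a).
  rewrite Rmult_comm. fold (ln (G S a) / (a - 1)). lra.
Qed.

Lemma renyiTr_eig a sigma : Cre (renyiTr dA dB dC a rho sigma) =
  Rsum (seq 0 (length lBC)) (fun j => pw (1 - a) (eigval lBC sigma j) *
    quad lBC (margBC dA (M a)) (eigvec lBC sigma j)).
Proof.
  unfold renyiTr. fold L lAC lBC lC rAC rBC rC. fold (Rho a) (P a) (Q a).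
  rewrite tr_cyclic, (tr_mul_lift PTBC). unfold Opow. fold lBC.
  rewrite Otr_mul_Ofun, Cre_Csum. apply Rsum_ext; intros j _. apply Cre_scale.
Qed.

(** The order of quantifiers is essential: [dl] is fixed before [sigma], so the bound passes to the
    infimum. *)
Lemma renyiTr_lower : forall eps, 0 < eps -> exists dl, 0 < dl /\
  forall a, a <> 1 -> Rabs (a - 1) < dl -> forall sigma,
    density lBC sigma -> supp_incl L rho (liftBC sigma) ->
    CMI dA dB dC rho - 3 * eps <= / (a - 1) * ln (Cre (renyiTr dA dB dC a rho sigma)).
Proof.
  intros eps Heps. set (n := length lBC).
  pose proof (eig_system lBC rBC HlBC (proj1 posdef_BC)) as HB.
  assert (HBpos : forall k, (k < n)%nat -> 0 < eigval lBC rBC k)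
    by (intros k Hk; exact (sys_posdef lBC rBC _ _ HB k posdef_BC Hk)).
  destruct (positive_lower_bound (seq 0 n) (eigval lBC rBC)) as [c [Hc Hcl]].
  { intros k Hk. apply in_seq in Hk. apply HBpos; lia. }
  destruct tangent_M as [M' HM].
  destruct (tangent_lipschitz lBC _ _ _ (tangent_marg PTBC M rho M' HM)) as [K [d1 [HK [Hd1 HLip]]]].
  destruct (perturbed_power_bound c (INR n * (INR n * (4 * K))) Hc) as [B [d2 [HB0 [Hd2 [Hd2' Hpow]]]]].
  { pose proof (pos_INR n). repeat apply Rmult_le_pos; lra. }
  assert (HI : tangent L (fun _ => Odelta) Odelta (fun _ _ => Czero))
    by (intros i j _ _; split; [reflexivity|apply Cderiv_const]).
  destruct (G_deriv _ _ HI) as [H1 HD].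
  replace (Cre (Otr L (Omul L rho (fun _ _ => Czero)))) with 0 in HD.
  2:{ unfold Otr, Omul. rewrite (Csum_ext _ _ (fun _ => Czero)), Csum_zero; [reflexivity|].
      intros i _. rewrite (Csum_ext _ _ (fun _ => Czero)), Csum_zero; [reflexivity|]. intros; ring. }
  set (D := eta_sum L rho - eta_sum lAC rAC + eta_sum lC rC + 0) in HD.
  destruct (HD eps Heps) as [d3 Hd3].
  assert (Htau : forall a, G (fun _ => Odelta) a = Cre (Otr lBC (margBC dA (M a)))).
  { intros a. unfold G. rewrite tr_cyclic, (marg_tr PTBC). f_equal. apply Otr_ext.
    apply Omul_delta_r; [exact HL|intros ? ? _ _; reflexivity]. }
  (* Of the three losses of [eps], one comes from the difference quotient of [Tr T_a] and one from
     the error terms of [perturbed_power_bound] summed over [j]. The third is left to the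
     logarithm. *)
  set (B' := CMI dA dB dC rho - 2 * eps).
  set (nB := INR n * B). assert (HnB : 0 <= nB) by (apply Rmult_le_pos; [apply pos_INR|exact HB0]).
  (* The last three thresholds give [nB |e| <= eps], [|e| |B'| <= 1/2] and [2 |e| B'^2 <= eps]; each
     [+ 1] keeps its denominator positive. *)
  exists (Rmin (Rmin d1 d2) (Rmin d3 (Rmin (eps / (nB + 1))
    (Rmin (/ (2 * (Rabs B' + 1))) (eps / (2 * B'² + 1)))))).
  pose proof (Rabs_pos B') as HaB. pose proof (Rle_0_sqr B') as HsB.
  assert (Hq1 : 0 < eps / (nB + 1)) by (apply Rdiv_lt_0_compat; lra).
  assert (Hq2 : 0 < / (2 * (Rabs B' + 1))) by (apply Rinv_0_lt_compat; lra).
  assert (Hq3 : 0 < eps / (2 * B'² + 1)) by (apply Rdiv_lt_0_compat; lra).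
  split; [repeat apply Rmin_pos; try assumption; apply cond_pos|].
  intros a Ha Had sigma [Hpsd Htrs] Hsupp.
  apply Rmin_Rgt_l in Had. destruct Had as [Had Had'].
  apply Rmin_Rgt_l in Had. destruct Had as [Ha1 Ha2].
  apply Rmin_Rgt_l in Had'. destruct Had' as [Ha3 Had].
  apply Rmin_Rgt_l in Had. destruct Had as [Ha4 Had].
  apply Rmin_Rgt_l in Had. destruct Had as [Ha5 Ha6].
  set (e := 1 - a). assert (He : e <> 0) by (unfold e; lra).
  assert (Hea : Rabs (a - 1) = Rabs e) by (unfold e; rewrite Rabs_minus_sym; reflexivity).
  rewrite Hea in *. pose proof (Rabs_pos_lt e He) as Hep.
  pose proof (eig_system lBC sigma HlBC (proj1 Hpsd)) as HSg.
  set (W := eigvec lBC sigma) in *. set (s := eigval lBC sigma) in *.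
  set (r := fun j => quad lBC rBC (W j)). set (t := fun j => quad lBC (margBC dA (M a)) (W j)).
  assert (HW : forall j, (j < n)%nat -> inner lBC (W j) (W j) = Cone)
    by (intros j Hj; exact (sys_unit lBC sigma W s j HSg Hj)).
  assert (Hs0 : forall j, (j < n)%nat -> 0 < s j).
  { intros j Hj. apply (supp_incl_eigval_pos PTBC rho sigma j HlBC (proj1 dims_nonempty) Hpd Hpsd Hsupp Hj). }
  assert (Hssum : Rsum (seq 0 n) s = 1).
  { rewrite (sys_trace_val lBC sigma W s HlBC HSg) in Htrs. injection Htrs; auto. }
  assert (Hs1 : forall j, (j < n)%nat -> s j <= 1).
  { intros j Hj. rewrite <- Hssum. apply (Rsum_ge_term (seq 0 n) s); [|apply in_seq; lia].
    intros i Hi. apply in_seq in Hi. left; apply Hs0; lia. }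
  assert (Hr0 : forall j, (j < n)%nat -> c <= r j).
  { intros j Hj. apply (quad_ge lBC rBC _ _ c (W j) HlBC HB); [|apply HW; exact Hj].
    intros k Hk. apply Hcl. apply in_seq; fold n in Hk; lia. }
  assert (Hrsum : Rsum (seq 0 n) r = 1).
  { unfold r, quad, n. rewrite <- Cre_Csum, (sys_trace lBC sigma W s HlBC HSg), (proj2 density_BC). reflexivity. }
  assert (Hr1 : forall j, (j < n)%nat -> r j <= 1).
  { intros j Hj. rewrite <- Hrsum. apply (Rsum_ge_term (seq 0 n) r); [|apply in_seq; lia].
    intros i Hi. apply in_seq in Hi. specialize (Hr0 i ltac:(lia)). lra. }
  assert (Htsum : Rsum (seq 0 n) t = G (fun _ => Odelta) a).
  { rewrite Htau. unfold t, quad, n. rewrite <- Cre_Csum, (sys_trace lBC sigma W s HlBC HSg). reflexivity. }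
  assert (Htr' : forall j, (j < n)%nat -> Rabs (t j - r j) <= INR n * (INR n * (4 * K)) * Rabs e).
  { intros j Hj. eapply Rle_trans.
    - apply (quad_lipschitz lBC _ _ (W j) (K * Rabs e)).
      + intros i Hi. apply (unit_vector_entry lBC); [apply HW; exact Hj|exact Hi].
      + intros i Hi k Hk. rewrite <- Hea. apply HLip; auto. rewrite Hea; exact Ha1.
    - fold n. right; ring. }
  set (X := Cre (renyiTr dA dB dC a rho sigma)).
  assert (EX : X = Rsum (seq 0 n) (fun j => t j * Rpower (s j) e)).
  { unfold X. rewrite renyiTr_eig. apply Rsum_ext; intros j Hj. apply in_seq in Hj. fold W s e.
    unfold pw. destruct (Rlt_dec 0 (s j)) as [_|Hn]; [apply Rmult_comm|exfalso; apply Hn, Hs0; lia]. }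
  assert (Hall : forall j, In j (seq 0 n) -> 0 < t j /\
    t j * Rpower (s j) e / e <= t j / e + r j * ln (r j) + (s j - r j) + B * Rabs e).
  { intros j Hj. apply in_seq in Hj. assert (Hj' : (j < n)%nat) by lia.
    apply Hpow; auto. }
  assert (Hn0 : seq 0 n <> nil).
  { intros E0. rewrite E0 in Hssum. simpl in Hssum. lra. }
  assert (HX : 0 < X).
  { rewrite EX. apply Rsum_pos; [exact Hn0|]. intros j Hj.
    apply Rmult_lt_0_compat; [apply Hall; exact Hj|apply exp_pos]. }
  assert (HXe : X / e <= G (fun _ => Odelta) a / e + eta_sum lBC rBC + nB * Rabs e).
  { assert (HP : Rsum (seq 0 n) (fun j => r j * ln (r j)) <= eta_sum lBC rBC).
    { eapply Rle_trans; [apply (peierls_xlnx lBC rBC _ _ sigma W s HlBC HB HSg HBpos)|].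
      - intros j Hj. specialize (Hr0 j Hj). unfold r in Hr0. lra.
      - right. apply Rsum_ext; intros k Hk. apply in_seq in Hk. unfold eta.
        destruct (Rlt_dec 0 _) as [_|Hn]; [reflexivity|exfalso; apply Hn, HBpos; fold n in Hk; lia]. }
    (* The terms are summed with the factor [/ e] already inside, so no inequality is multiplied by
       a quantity of unknown sign. *)
    assert (HS : Rsum (seq 0 n) (fun j => / e * (t j * Rpower (s j) e)) <=
      Rsum (seq 0 n) (fun j => / e * t j + r j * ln (r j) + (s j - r j) + B * Rabs e)).
    { apply Rsum_le; intros j Hj. destruct (Hall j Hj) as [_ H]. unfold Rdiv in H. lra. }
    rewrite !Rsum_add, Rsum_sub, Rsum_const, !Rsum_mul_l, length_seq, <- EX, Htsum, Hssum, Hrsum in HS.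
    unfold Rdiv, nB. lra. }
  specialize (Hd3 (a - 1) ltac:(lra) ltac:(rewrite Hea; exact Ha3)).
  replace (1 + (a - 1)) with a in Hd3 by ring. rewrite H1 in Hd3.
  apply Rlt_le, Rabs_le_inv in Hd3.
  assert (HnBe : nB * Rabs e <= eps).
  { apply Rle_trans with ((nB + 1) * (eps / (nB + 1))); [apply Rmult_le_compat; lra|right; field; lra]. }
  assert (HB1 : Rabs e * Rabs B' <= / 2).
  { apply Rle_trans with (/ (2 * (Rabs B' + 1)) * (Rabs B' + 1)); [apply Rmult_le_compat; lra|right; field; lra]. }
  assert (HB2 : 2 * Rabs e * B'² <= eps).
  { apply Rle_trans with (eps / (2 * B'² + 1) * (2 * B'² + 1)); [|right; field; lra].
    replace (2 * Rabs e * B'²) with (Rabs e * (2 * B'²)) by ring. apply Rmult_le_compat; lra. }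
  assert (HXB : (X - 1) / e <= - B').
  (* The two divergent [/ e] terms cancel here; since [e = 1 - a], the quotient of [Tr T_a - 1] by
     [e] is minus its difference quotient in [a]. *)
  { replace ((X - 1) / e) with (X / e - / e) by (field; exact He).
    replace ((G (fun _ => Odelta) a - 1) / (a - 1)) with (- (G (fun _ => Odelta) a / e - / e)) in Hd3
      by (unfold e; field; lra).
    unfold B'. rewrite CMI_eta. unfold D in Hd3. lra. }
  pose proof (renyi_scalar_lower e X B' He HX HXB HB1) as Hfin.
  replace (- e) with (a - 1) in Hfin by (unfold e; ring). unfold B' in *. lra.
Qed.

Lemma renyiCMI_limit : limit1_in (fun a => renyiCMI dA dB dC a rho)
  (fun a => 0 <= a /\ a <> 1) (CMI dA dB dC rho) 1.
Proof.
  intros eps Heps.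
  destruct (renyiTr_upper (eps / 2) ltac:(lra)) as [d1 [Hd1 H1]].
  destruct (renyiTr_lower (eps / 6) ltac:(lra)) as [d2 [Hd2 H2]].
  exists (Rmin d1 d2). split; [apply Rmin_pos; assumption|].
  intros a [[_ Ha] Hdist]. simpl in *. unfold Rdist in *.
  apply Rmin_Rgt_l in Hdist. destruct Hdist as [Ha1 Ha2].
  (* The infimum lies between the uniform lower bound and the value at the admissible candidate
     [rBC]. *)
  assert (Hb : CMI dA dB dC rho - 3 * (eps / 6) <= renyiCMI dA dB dC a rho
    <= / (a - 1) * ln (Cre (renyiTr dA dB dC a rho rBC))).
  { unfold renyiCMI. apply Rinf_between.
    - intros y [sigma [Hden [Hsup ->]]]. apply H2; assumption.
    - exists rBC. split; [exact density_BC|]. split; [|reflexivity].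
      apply (supp_incl_lift PTBC); [exact HlBC|exact posdef_BC]. }
  specialize (H1 a Ha Ha1). apply Rabs_def1; lra.
Qed.
End RenyiLimit.

Theorem mainTheorem8 (dA dB dC : nat) (rho : Op (nat * nat * nat))
  (Hpd : posdef (enABC dA dB dC) rho)
  (Htr : Otr (enABC dA dB dC) rho = Cone) :
  limit1_in (fun a => renyiCMI dA dB dC a rho)
            (fun a => 0 <= a /\ a <> 1)
            (CMI dA dB dC rho) 1.
Proof. exact (renyiCMI_limit dA dB dC rho Hpd Htr). Qed.
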